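(* For all integers $d>1$ and $k>2$, there does not exist a $(d,k)$-digraph; that is, there is no digraph with maximum out-degree at most $d$ and diameter at most $k$ having exactly $d+d^2+\cdots+d^k$ vertices.
   Context: For natural numbers $d,k$, let $\mathcal{D}(d,k)$ denote the collection of (finite) digraphs with maximum out-degree at most $d$ and diameter at most $k$ (the diameter is the maximum, over all ordered pairs of vertices $(u,v)$, of the length of a shortest directed path from $u$ to $v$). The directed Moore bound is $M_{d,k} := 1+d+\cdots+d^k$; every digraph in $\mathcal{D}(d,k)$ has at most $M_{d,k}$ vertices. An almost Moore digraph, or $(d,k)$-digraph, is a digraph in $\mathcal{D}(d,k)$ of order $M_{d,k}-1$. *)

(* Defs.v *)
From mathcomp Require Import all_boot.

Set Implicit Arguments.
Unset Strict Implicit.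
Unset Printing Implicit Defensive.

(* A digraph is a finType of vertices with an arbitrary adjacency relation
   [e]; [e u v] means that there is an arc from [u] to [v].  Loops are allowed
   and count towards the out-degree; there are no parallel arcs. *)

Definition outdeg (T : finType) (e : rel T) (u : T) : nat :=
  #|[set v | e u v]|.

Definition walk (T : finType) (e : rel T) (u v : T) (n : nat) : bool :=
  [exists p : n.-tuple T, path e u p && (last u p == v)].

(* A shortest path has no repeated vertex, so its length is less than #|T|;
   see [dist_attained] and [dist_min].  When [v] is not reachable from [u] the
   value is the meaningless #|T|, hence the separate connectivity requirement
   in [diameter_at_most]. *)
Definition dist (T : finType) (e : rel T) (u v : T) : nat :=
  find (walk e u v) (iota 0 #|T|).

Definition strongly_connected (T : finType) (e : rel T) : bool :=
  [forall u, forall v, connect e u v].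

Definition diameter (T : finType) (e : rel T) : nat :=
  \max_(u : T) \max_(v : T) dist e u v.

(* A digraph that is not strongly connected has infinite diameter. *)
Definition diameter_at_most (k : nat) (T : finType) (e : rel T) : bool :=
  strongly_connected e && (diameter e <= k).

(* The class D(d, k). *)
Definition in_D (d k : nat) (T : finType) (e : rel T) : bool :=
  [forall u, outdeg e u <= d] && diameter_at_most k e.

Definition moore_bound (d k : nat) : nat := \sum_(0 <= i < k.+1) d ^ i.

Definition almost_moore_digraph (d k : nat) (T : finType) (e : rel T) : bool :=
  in_D d k e && (#|T| == moore_bound d k - 1).

Lemma moore_bound_sub1 (d k : nat) :
  moore_bound d k - 1 = \sum_(1 <= i < k.+1) d ^ i.
Proof. by rewrite /moore_bound big_ltn // expn0 addKn. Qed.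

Lemma dist_min (T : finType) (e : rel T) (u v : T) (p : seq T) :
  path e u p -> last u p = v -> dist e u v <= size p.
Proof.
move=> ep lp; rewrite leqNgt; apply/negP => ltpd.
have ltpT : size p < #|T|.
  by rewrite (leq_trans ltpd) // -[leqRHS](size_iota 0) find_size.
have := before_find 0 ltpd; rewrite nth_iota // add0n // => /negbT/negP[].
rewrite /walk; apply/existsP; by exists (in_tuple p); rewrite ep lp eqxx.
Qed.

Lemma dist_attained (T : finType) (e : rel T) (u v : T) :
  connect e u v ->
  exists p : seq T, [/\ path e u p, last u p = v & size p = dist e u v].
Proof.
move=> /connectP[p0 ep0 ->]; case/shortenP: ep0 => p ep up _.
have ltpT : size p < #|T| by rewrite -[_.+1]/(size (u :: p)) -(card_uniqP up) max_card.
have hasw : has (walk e u (last u p)) (iota 0 #|T|).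
  apply/hasP; exists (size p); first by rewrite mem_iota.
  by rewrite /walk; apply/existsP; exists (in_tuple p); rewrite ep eqxx.
have := nth_find 0 hasw; rewrite nth_iota; last by rewrite -[ltnRHS](size_iota 0) -has_find.
case/existsP=> q /andP[eq /eqP lq]; exists q; split=> //.
by rewrite size_tuple.
Qed.

(* Main.v *)
Require Import Defs.
From HB Require Import structures.
From mathcomp Require Import all_boot all_order all_algebra all_field.
From mathcomp Require Import zify ring.

(** Let [q(x) = 1 + x + ... + x^k].  In an almost Moore digraph every vertex [u]
    has exactly one repeat [r(u)], reached from [u] by two walks of length at
    most [k], and the map [r] is an automorphism.  If [A] is the adjacency matrix,
    [J] the all-one matrix and [n] the order, then [B = A - (d/n) J] satisfies
    [q(B) = P], the permutation matrix of [r], and [tr B^j = - d^j] for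
    [0 < j < k] because there are no short cycles.

    Every eigenvalue [x] of [B] has [q(x) = z] for a root of unity [z].  If
    [z = 1], then [x = 0] or [x^k = 1].  If [z <> 1], then [x] is a root of the
    trinomial [X^(k+1) - z X + (z - 1)]; Ljunggren's trick, applied in all complex
    embeddings simultaneously, shows that all roots of the trinomial outside the
    [(k+2)]-th roots of unity are conjugate over [Q(z)].  Since the first [k-1]
    power sums of the roots of the trinomial vanish, the sum of the [j]-th powers
    over a Galois orbit of eigenvalues only depends on the residue of [j] modulo
    [k] and [k+2], up to multiplication by units.  For [k <> 4] there are two such
    exponents [j <> j'] below [k], whence [d^j = d^j'].  For [k = 4] the traces
    bound from below the multiplicity of [z = 1], i.e. the number of cycles of [r],
    and this contradicts the number of vertices that [r] moves. *)

Set Implicit Arguments.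
Unset Strict Implicit.
Unset Printing Implicit Defensive.
Import Order.TTheory GRing.Theory Num.Theory.

(** * Walks in almost Moore digraphs *)

(** Entry (u, v) of the m-th power of the adjacency matrix, with truth values read as 0 or 1. *)
Fixpoint walks (T : finType) (e : rel T) (m : nat) (u v : T) : nat :=
  if m is m'.+1 then \sum_w e u w * walks e m' w v else u == v.

Section Walks.
Variables (T : finType) (e : rel T).
Local Notation W := (walks e).

Lemma sum_eq_mull (u : T) (F : T -> nat) : \sum_w (u == w) * F w = F u.
Proof.
rewrite (bigD1 u) //= eqxx mul1n big1 ?addn0 // => w wu.
by rewrite eq_sym (negPf wu).
Qed.

Lemma sum_eq_mulr (u : T) (F : T -> nat) : \sum_w F w * (w == u) = F u.
Proof. by rewrite -[RHS]sum_eq_mull; apply: eq_bigr => w _; rewrite mulnC eq_sym. Qed.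

Lemma walks1 u v : W 1 u v = e u v.
Proof. exact: sum_eq_mulr. Qed.

Lemma walksD a b u v : W (a + b) u v = \sum_w W a u w * W b w v.
Proof.
elim: a u => [|a IHa] u /=; first by rewrite sum_eq_mull.
under eq_bigr do rewrite IHa big_distrr /=.
rewrite exchange_big /=; apply: eq_bigr => w _.
by rewrite big_distrl /=; apply: eq_bigr => x _; rewrite mulnA.
Qed.

Lemma walksSr m u v : W m.+1 u v = \sum_w W m u w * e w v.
Proof. by rewrite -addn1 walksD; apply: eq_bigr => w _; rewrite walks1. Qed.

Lemma walks_cat a b u w v : 0 < W a u w -> 0 < W b w v -> 0 < W (a + b) u v.
Proof. by move=> au bv; rewrite walksD (bigD1 w) //= addn_gt0 muln_gt0 au bv. Qed.

Lemma walks_gt0S m u v : 0 < W m.+1 u v -> exists2 w, e u w & 0 < W m w v.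
Proof.
rewrite lt0n sum_nat_eq0 negb_forall => /existsP[w].
by rewrite -lt0n muln_gt0 lt0b => /andP[? ?]; exists w.
Qed.

Lemma walks_path u p : path e u p -> 0 < W (size p) u (last u p).
Proof.
elim: p u => [|w p IHp] u /=; first by rewrite eqxx.
by move=> /andP[uw wp]; rewrite (bigD1 w) //= uw mul1n addn_gt0 IHp.
Qed.

Lemma walks_closed (P : T -> Prop) m u v :
  (forall x y, P x -> e x y -> P y) -> P u -> 0 < W m u v -> P v.
Proof.
move=> Pcl; elim: m u => [|m IHm] u Pu; first by rewrite lt0b => /eqP <-.
by case/walks_gt0S=> w uw; apply: IHm; apply: Pcl uw.
Qed.

Lemma outdegE u : outdeg e u = \sum_v e u v.
Proof. by rewrite /outdeg -sum1dep_card big_mkcond; apply: eq_bigr => v _;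
  case: (e u v). Qed.

Lemma sum_walks_leq d : (forall u, outdeg e u <= d) ->
  forall m u, \sum_v W m u v <= d ^ m.
Proof.
move=> out_d; elim=> [|m IHm] u.
  by rewrite (eq_bigr (fun v => (u == v) * 1)) ?sum_eq_mull // => v _; rewrite muln1.
rewrite exchange_big /= expnS; apply: leq_trans (_ : \sum_w e u w * d ^ m <= _).
  by apply: leq_sum => w _; rewrite -big_distrr /= leq_mul2l IHm orbT.
by rewrite -big_distrl /= leq_mul2r -outdegE out_d orbT.
Qed.

Lemma sum_walks d : (forall u, outdeg e u = d) ->
  forall m u, \sum_v W m u v = d ^ m.
Proof.
move=> out_d; elim=> [|m IHm] u.
  by rewrite (eq_bigr (fun v => (u == v) * 1)) ?sum_eq_mull // => v _; rewrite muln1.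
rewrite exchange_big /= expnS -{1}(out_d u) outdegE big_distrl; apply: eq_bigr => w _.
by rewrite -big_distrr /= IHm.
Qed.

Lemma sum_walks_in d : (forall v, \sum_u e u v = d) ->
  forall m v, \sum_u W m u v = d ^ m.
Proof.
move=> in_d; elim=> [|m IHm] v.
  by rewrite (eq_bigr (fun u => 1 * (u == v))) ?sum_eq_mulr // => u _; rewrite mul1n.
rewrite (eq_bigr (fun u => \sum_w W m u w * e w v)) => [|u _]; last by rewrite walksSr.
rewrite exchange_big /= expnSr -[X in _ = _ * X](in_d v) big_distrr;
  apply: eq_bigr => w _.
by rewrite -big_distrl /= IHm.
Qed.

Lemma walks_leq_diameter k : diameter_at_most k e ->
  forall u v, exists2 m, m <= k & 0 < W m u v.
Proof.
move=> /andP[/forallP sc diam] u v; have /forallP/(_ v) uv := sc u.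
have [p [up lp sp]] := dist_attained uv.
exists (size p); last by rewrite -lp walks_path.
rewrite sp (leq_trans _ diam) // /diameter.
by rewrite (leq_trans _ (leq_bigmax u)) // (leq_trans _ (leq_bigmax v)).
Qed.

End Walks.

Lemma sum_nat_eq1 (T : finType) (F : T -> nat) : \sum_v F v = 1 ->
  exists u, forall v, F v = (v == u).
Proof.
move=> F1; have: \sum_v F v != 0 by rewrite F1.
rewrite sum_nat_eq0 negb_forall => /existsP[u Fu]; exists u => v.
have : F u + \sum_(w | w != u) F w = 1 by rewrite -F1 [RHS](bigD1 u).
have [-> | vu] := eqVneq v u; first by move: Fu; rewrite -lt0n /=; lia.
move: Fu; rewrite -lt0n => Fu E.
have : F v <= \sum_(w | w != u) F w by rewrite (bigD1 v) //= leq_addr.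
by rewrite /=; lia.
Qed.

(** * Degrees, girth and the repeat automorphism *)

Section AlmostMoore.
Variables (d k : nat) (T : finType) (e : rel T).
Hypotheses (d1 : 1 < d) (k2 : 2 < k) (amd : almost_moore_digraph d k e).
Local Notation W := (walks e).
Local Notation N := (fun u v => \sum_(m < k.+1) walks e m u v).

Lemma amd_card : #|T| = d * \sum_(m < k) d ^ m.
Proof.
case/andP: amd => _ /eqP->; rewrite /moore_bound big_nat_recl // expn0 addKn.
by rewrite big_mkord big_distrr; apply: eq_bigr => i _; rewrite /= expnS.
Qed.

Lemma amd_card1 : #|T|.+1 = \sum_(m < k.+1) d ^ m.
Proof.
rewrite big_ord_recl expn0 amd_card big_distrr; congr _.+1.
by apply: eq_bigr => i _; rewrite /= expnS.
Qed.

Lemma amd_walks_gt0 u v : 0 < N u v.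
Proof.
case/andP: amd => /andP[_ /walks_leq_diameter/(_ u v)[m mk muv]] _.
have mk1 : m < k.+1 by [].
by rewrite (bigD1 (Ordinal mk1)) //= addn_gt0 muv.
Qed.

(** With S = 1 + ... + d^(k-1), a vertex of out-degree below d would start at most 1 + (d-1) S walks
    of length at most k. This is less than the order d S, so some vertex would not be reached. *)
Lemma amd_outdeg u : outdeg e u = d.
Proof.
have out_d v : outdeg e v <= d by case/andP: amd => /andP[/forallP/(_ v)].
apply/eqP; rewrite eqn_leq out_d leqNgt; apply/negP => lt_d.
have : #|T| <= \sum_v N u v.
  by rewrite -sum1_card; apply: leq_sum => v _; apply: amd_walks_gt0.
rewrite exchange_big big_ord_recl /=.
have -> : \sum_v (u == v) = 1.
  by rewrite (eq_bigr (fun v => (u == v) * 1)) ?sum_eq_mull // => v _; rewrite muln1.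
set S := \sum_(i < k) d ^ i.
have S2 : 1 < S.
  rewrite /S; case: (k) k2 => [|[|k']] // _; rewrite !big_ord_recl expn0 expn1; lia.
suff : \sum_(i < k) \sum_v \sum_w e u w * W i w v <= d.-1 * S.
  have dS : d * S = d.-1 * S + S by rewrite -mulSnr prednK // ltnW.
  move=> le1 le2; have := leq_trans le2 (leq_add (leqnn 1) le1).
  by rewrite amd_card -/S dS; move: S2; clear; lia.
rewrite big_distrr; apply: leq_sum => i _; rewrite exchange_big /=.
apply: leq_trans (_ : \sum_w e u w * d ^ i <= _).
  by apply: leq_sum => w _; rewrite -big_distrr /= leq_mul2l (sum_walks_leq out_d) orbT.
by rewrite -big_distrl /= leq_mul2r -outdegE; apply/orP; right;
  rewrite -ltnS prednK // ltnW.
Qed.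

(** The walks of length at most k from [u] number [#|T|.+1], and every vertex ends at least one of
    them, so exactly one vertex ends two. *)
Lemma amd_repeat_exists u : exists x, forall v, N u v = (v == x).+1.
Proof.
have [|x xE] := @sum_nat_eq1 T (fun v => (N u v).-1); last first.
  by exists x => v; rewrite -xE prednK ?amd_walks_gt0.
have : \sum_v N u v = #|T|.+1.
  by rewrite exchange_big amd_card1; apply: eq_bigr => i _;
    rewrite (sum_walks amd_outdeg).
rewrite (eq_bigr (fun v => (N u v).-1 + 1)) => [|v _];
  last by rewrite addn1 prednK ?amd_walks_gt0.
by rewrite big_split sum1_card /= -[X in _ = X]add1n => /addIn.
Qed.

(** In an almost Moore digraph the pick succeeds by [amd_repeat_exists]; the default [u] only makes
    the function total. *)
Definition repeat u := odflt u [pick x | [forall v, N u v == (v == x).+1]].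

Lemma amd_repeat u v : N u v = (v == repeat u).+1.
Proof.
rewrite /repeat; case: pickP => [x /forallP/(_ v)/eqP // | no].
by have [x xE] := amd_repeat_exists u; have /forallP[] := no x => w; rewrite xE.
Qed.

Lemma repeat_two u v a b : a < b <= k -> 0 < W a u v -> 0 < W b u v -> repeat u = v.
Proof.
move=> /andP[ab bk] Wa Wb.
have : 1 < N u v -> repeat u = v by rewrite amd_repeat ltnS lt0b => /eqP.
apply.
have ak : a < k.+1 by lia.
have bk1 : b < k.+1 by lia.
rewrite (bigD1 (Ordinal ak)) //= (bigD1 (Ordinal bk1)) /=;
  last by rewrite -val_eqE /= gtn_eqF.
lia.
Qed.

Lemma repeat_fixed_walk u : repeat u = u -> exists2 j, 0 < j <= k & 0 < W j u u.
Proof.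
move=> ru; have := amd_repeat u u; rewrite ru big_ord_recl eqxx /= eqxx => -[].
move=> E; have : \sum_(i < k) W i.+1 u u != 0 by rewrite [X in X != 0]E.
rewrite sum_nat_eq0 negb_forall => /existsP[j]; rewrite -lt0n => Wj.
by exists j.+1 => //=; apply: ltn_ord.
Qed.

(** A closed walk of length j < k at [u] followed by an arc to x gives walks from [u] to x of
    lengths 1 and j + 1 <= k. So every out-neighbour of [u] would be its repeat, although there are
    d > 1 of them. *)
Lemma amd_girth j u : 0 < j < k -> W j u u = 0.
Proof.
move=> /andP[j0 jk]; apply/eqP; rewrite -leqn0 leqNgt; apply/negP => Wj.
have out1 : outdeg e u <= 1.
  rewrite -(cards1 (repeat u)); apply/subset_leq_card/subsetP => x.
  rewrite !inE => ux; apply/eqP; symmetry.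
  apply: (@repeat_two u x 1 (j + 1)); rewrite ?walks1 ?ux //; first by lia.
  by apply: walks_cat Wj _; rewrite walks1 ux.
by move: out1; rewrite amd_outdeg leqNgt d1.
Qed.

Local Notation indeg := (fun v => \sum_w e w v).

(** Both sides count the walks of length 1 to k + 1 from [u] to [v], cut after the first arc or
    before the last one: this is A (J + P) = (J + P) A entrywise. *)
Lemma repeat_comm u v :
  d + \sum_w e u w * (v == repeat w) = \sum_w e w v + e (repeat u) v.
Proof.
transitivity (\sum_(m < k.+1) W m.+1 u v).
  rewrite exchange_big /= -(amd_outdeg u) outdegE -big_split /=; apply: eq_bigr => w _.
  by rewrite -big_distrr /= amd_repeat mulnS.
transitivity (\sum_w (w == repeat u).+1 * e w v).
  rewrite (eq_bigr (fun m : 'I_k.+1 => \sum_w W m u w * e w v)) => [|m _];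
    last exact: walksSr.
  by rewrite exchange_big; apply: eq_bigr => w _; rewrite -big_distrl /= amd_repeat.
rewrite -[X in _ + X](sum_eq_mull (repeat u) (fun w => e w v)) -big_split /=.
by apply: eq_bigr => w _; rewrite mulSn eq_sym.
Qed.

Lemma sum_indeg : \sum_v indeg v = #|T| * d.
Proof.
rewrite exchange_big /= -sum_nat_const; apply: eq_bigr => u _.
by rewrite -outdegE amd_outdeg.
Qed.

(* A vertex of deficient in-degree is not a repeat, but every repeat has an arc
   to it.  Hence the out-neighbourhood of any repeat is exactly the set of
   deficient vertices; so all repeats start the same walks, which makes them
   fixed by [repeat] and puts a deficient vertex on a short cycle. *)
Lemma amd_indeg v : indeg v = d.
Proof.
apply/eqP/negPn/negP => vd.
have [s sd] : exists s, indeg s < d.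
  have [/existsP// | ] := boolP [exists s, \sum_w e w s < d].
  rewrite negb_exists => /forallP ge_d.
  have := sum_indeg; rewrite -sum_nat_const (bigD1 v) //= [RHS](bigD1 v) //= => E.
  have : \sum_(i | i != v) d <= \sum_(i | i != v) indeg i.
    by apply: leq_sum => i _; rewrite leqNgt ge_d.
  by move: (ge_d v) vd E; rewrite /=; lia.
have in_gt0 w : 0 < indeg w.
  by have := repeat_comm w w; case: (e _ w) => /=; lia.
have deficient w : indeg w < d -> (forall u, e (repeat u) w) /\ (forall u, repeat u != w).
  move=> wd; split=> u.
    by have := repeat_comm u w; case: (e _ w) => //=; lia.
  apply/eqP => uw; have := in_gt0 u; rewrite lt0n sum_nat_eq0 negb_forall => /existsP[x].
  rewrite -lt0n lt0b => xu; have := repeat_comm x w.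
  rewrite (bigD1 u) //= xu uw eqxx mul1n; case: (e _ w) => /=; lia.
have [e_s r_s] := deficient s sd.
have nbr u w : e (repeat u) w = (indeg w < d).
  apply/idP/idP => [uw | /deficient[]//].
  have [/existsP[x /eqP xw] | ] := boolP [exists x, repeat x == w].
    case/negP: (r_s (repeat u)); apply/eqP.
    apply: (@repeat_two _ s 1 2); rewrite ?walks1 ?e_s //; first by lia.
    apply: (@walks_cat _ _ 1 1 _ w); first by rewrite walks1 uw.
    by rewrite walks1 -xw e_s.
  rewrite negb_exists => /forallP no_x; rewrite ltnNge; apply/negP => ge_d.
  have := repeat_comm u w; rewrite uw big1 => [|x _]; last first.
    by rewrite eq_sym (negPf (no_x x)) muln0.
  by move: ge_d; rewrite /=; lia.
pose C x := \sum_(m < k) \sum_w (indeg w < d) * W m w x.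
have NE u x : (x == repeat (repeat u)).+1 = (repeat u == x) + C x.
  rewrite -amd_repeat big_ord_recl; congr (_ + _); apply: eq_bigr => m _ /=.
  by apply: eq_bigr => w _; rewrite nbr.
(* [C x] counts the walks of length 1 to k from any repeat to x. If y were moved, the walks from y
   would give [C (repeat y)] = 2, and then 1 + 2 = 3 walks would lead from [repeat y] to itself. *)
pose y := repeat v; have ry : repeat y = y.
  apply/eqP/negPn/negP => nry.
  have := NE v (repeat y); have := NE (repeat v) (repeat y).
  rewrite -/y !eqxx [y == repeat y]eq_sym (negPf nry) /=; case: (_ == _) => /=; lia.
have [[|j] // jk Wj] := repeat_fixed_walk ry.
have [w yw Ww] := walks_gt0S Wj.
have wd : indeg w < d by rewrite -(nbr v w).
have [_ /(_ w)/negP[]] := deficient w wd; apply/eqP.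
apply: (@repeat_two _ w 0 j.+1) => //; first by rewrite /= eqxx.
by have := walks_cat (b := 1) Ww; rewrite addn1; apply; rewrite walks1 yw.
Qed.

(** By the constant in-degree, [#|T|.+1] walks of length at most k end at a given vertex, so it is
    the repeat of exactly one vertex. *)
Lemma repeat_inj : injective repeat.
Proof.
move=> u u' uu'; have : \sum_w N w (repeat u) = #|T|.+1.
  by rewrite exchange_big amd_card1; apply: eq_bigr => m _;
    rewrite (sum_walks_in amd_indeg).
rewrite (eq_bigr (fun w => (repeat u == repeat w) + 1)) => [|w _];
  last by rewrite amd_repeat addn1.
rewrite big_split sum1_card /= -[X in _ = X]add1n => /addIn/sum_nat_eq1[x xE].
have /esym := xE u; have /esym := xE u'; rewrite -uu' eqxx.
by do 2![case: eqP => // ->].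
Qed.

(** With all in-degrees equal to d, [repeat_comm] reduces to A P = P A. *)
Lemma repeat_aut u v : e (repeat u) (repeat v) = e u v.
Proof.
have := repeat_comm u (repeat v); rewrite amd_indeg => /addnI.
rewrite (eq_bigr (fun w => e u w * (w == v))) => [|w _]; last first.
  by rewrite (inj_eq repeat_inj) eq_sym.
by rewrite sum_eq_mulr; do 2!case: (e _ _).
Qed.

Lemma walks_repeat m u v : W m (repeat u) (repeat v) = W m u v.
Proof.
elim: m u => [|m IHm] u /=; first by rewrite (inj_eq repeat_inj).
rewrite (reindex_inj repeat_inj); apply: eq_bigr => w _.
by rewrite IHm repeat_aut.
Qed.

(* Some fixed vertex has two moved out-neighbours [w] and [repeat w]; the walks of
   length less than [k] starting there end at pairwise distinct moved vertices. *)
Lemma repeat_moved : (exists v, repeat v != v) ->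
  2 * \sum_(m < k) d ^ m <= #|[pred v | repeat v != v]|.
Proof.
case=> v0 v0P; have [/existsP[v1 /eqP v1P] | ] := boolP [exists v, repeat v == v];
  last first.
  rewrite negb_exists => /forallP all_moved.
  by rewrite (eq_card (B := T)) ?amd_card ?leq_mul2r ?d1 ?orbT // => v;
    rewrite inE all_moved.
have [u ru [w uw rw]] : exists2 u, repeat u = u & exists2 w, e u w & repeat w != w.
  have [|no] := boolP [exists u, (repeat u == u) && [exists w, e u w && (repeat w != w)]].
    by case/existsP=> u /andP[/eqP ru /existsP[w /andP[]]]; exists u => //; exists w.
  case/negP: v0P; apply/eqP; have := amd_walks_gt0 v1 v0.
  rewrite lt0n sum_nat_eq0 negb_forall => /existsP[m]; rewrite -lt0n.
  apply: (walks_closed (P := fun v => repeat v = v)) v1P => x y rx xy.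
  apply/eqP/negPn/negP => ry; case/negP: no; apply/existsP; exists x.
  by rewrite rx eqxx; apply/existsP; exists y; rewrite xy.
pose X v := \sum_(m < k) (W m w v + W m (repeat w) v).
(* As u is its own repeat, the empty walk accounts for the extra walk at u; hence exactly one walk
   of length 1 to k leads from u to each vertex. *)
have X1 v : X v <= 1.
  have : \sum_(m < k) W m.+1 u v = 1.
    by have := amd_repeat u v; rewrite ru big_ord_recl /= [v == u]eq_sym -addn1 => /addnI.
  move<-; apply: leq_sum => m _ /=.
  rewrite (bigD1 w) //= (bigD1 (repeat w)) //= uw -{1}ru repeat_aut uw !mul1n addnA.
  exact: leq_addr.
(* For fixed v, [repeat] matches the walks from w to v with those from [repeat w] to v, so [X v] is
   even. *)
have X0 v : repeat v = v -> X v = 0.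
  move=> rv; have := X1 v; rewrite /X big_split /=.
  have -> : \sum_(m < k) W m (repeat w) v = \sum_(m < k) W m w v.
    by apply: eq_bigr => m _; rewrite -{1}rv walks_repeat.
  by rewrite addnn; case: (\sum_(m < k) _).
have -> : 2 * \sum_(m < k) d ^ m = \sum_v X v.
  rewrite exchange_big /= big_distrr; apply: eq_bigr => m _.
  by rewrite big_split /= !(sum_walks amd_outdeg); lia.
rewrite -sum1_card [leqRHS]big_mkcond; apply: leq_sum => v _ /=.
by rewrite inE; case: eqP => [/X0-> | _] //=.
Qed.

Lemma iter_repeat_aut n u v : e (iter n repeat u) (iter n repeat v) = e u v.
Proof. by elim: n => //= n IHn; rewrite repeat_aut. Qed.

Lemma iter_repeat_inj n : injective (iter n repeat).
Proof. by elim: n => //= n IHn u v /repeat_inj/IHn. Qed.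

(* In out-degree 2, an automorphism fixing a vertex fixes or swaps its two
   out-neighbours, so its square fixes them. *)
Lemma repeat_order_pow2 v0 : d = 2 -> repeat (repeat v0) = v0 ->
  exists t, forall v, iter (2 ^ t) repeat v = v.
Proof.
move=> d2 v0P; have iter2 t v : iter (2 ^ t.+1) repeat v = iter (2 ^ t) repeat (iter
  (2 ^ t) repeat v).
  by rewrite expnS mul2n -addnn iterD.
have iter_le t t' v : t <= t' -> iter (2 ^ t) repeat v = v -> iter (2 ^ t') repeat v = v.
  by move=> /subnKC <-; elim: (t' - t) => [|n IHn];
    rewrite ?addn0 // addnS iter2 => /IHn E; rewrite !E.
have /fin_all_exists[f fP] v : exists t, iter (2 ^ t) repeat v = v.
  have := amd_walks_gt0 v0 v; rewrite lt0n sum_nat_eq0 negb_forall => /existsP[m].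
  rewrite -lt0n; apply: (walks_closed (P := fun v =>
    exists t, iter (2 ^ t) repeat v = v)); last by exists 1.
  move=> x y [t tx] xy; exists t.+1; rewrite iter2;
    set phi := iter (2 ^ t) repeat in tx *.
  have [yy | yy] := eqVneq (phi y) y; first by rewrite yy.
  have phi_nbr z : e x z -> e x (phi z) by rewrite -{2}tx iter_repeat_aut.
  have sub : [set phi y; y] = [set z | e x z].
    apply/eqP; rewrite eqEcard cards2 yy -/(outdeg e x) amd_outdeg d2 leqnn andbT.
    by apply/subsetP => z; rewrite !inE => /orP[] /eqP->; rewrite ?phi_nbr.
  have : phi (phi y) \in [set phi y; y] by rewrite sub inE !phi_nbr.
  by rewrite !inE (inj_eq (@iter_repeat_inj _)) (negPf yy) => /eqP.
by exists (\max_v f v) => v; apply: iter_le (fP v); apply: leq_bigmax.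
Qed.

End AlmostMoore.

Local Open Scope ring_scope.

(** * Galois conjugates of algebraic numbers *)

(** Inside the number field generated by the roots of the minimal polynomial, which is a splitting
    field, sending x to y extends to an automorphism; this one then extends to [algC]. *)
Lemma algC_conjugate x y : root (minCpoly x) y ->
  {nu : {rmorphism algC -> algC} | nu x = y}.
Proof.
move=> rxy; have [r Dr] := closed_field_poly_normal (minCpoly x).
rewrite (monicP (minCpoly_monic x)) scale1r in Dr.
have [p [Dp _] min_p] := minCpolyP x.
have xr : x \in r by rewrite -root_prod_XsubC -Dr root_minCpoly.
have yr : y \in r by rewrite -root_prod_XsubC -Dr.
have [Qn [QnC [s Ds genQn]]] := num_field_exists r.
have [x0 x0s Dx] : {x0 | x0 \in s & QnC x0 = x}.
  by move: xr; rewrite -Ds => /mapP/sig2_eqW[x0 ? ->]; exists x0.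
have [y0 y0s Dy] : {y0 | y0 \in s & QnC y0 = y}.
  by move: yr; rewrite -Ds => /mapP/sig2_eqW[y0 ? ->]; exists y0.
have QnCr q : map_poly QnC (map_poly (in_alg Qn) q) = map_poly ratr q.
  by rewrite -map_poly_comp; apply: eq_map_poly => a /=; rewrite alg_num_field fmorph_rat.
have Dp0 : map_poly (in_alg Qn) p = \prod_(z <- s) ('X - z%:P).
  apply: (map_poly_inj QnC); rewrite QnCr -Dp Dr -Ds big_map rmorph_prod /=.
  by apply: eq_bigr => z _; rewrite map_polyXsubC.
have pover : map_poly (in_alg Qn) p \is a polyOver 1%VS by apply/polyOver1P; exists p.
have Dmin1 : minPoly 1 x0 %| map_poly (in_alg Qn) p.
  by apply: minPoly_dvdp => //; rewrite Dp0 root_prod_XsubC.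
have ry : root (minPoly 1 x0) y0.
  have /polyOver1P[q Dq] := minPolyOver 1 x0.
  have: root (map_poly ratr q) x by rewrite -QnCr -Dq -Dx fmorph_root root_minPoly.
  rewrite min_p => /dvdpP[q1 Dq1]; rewrite Dq Dq1 rmorphM rootM /= orbC.
  by rewrite Dp0 root_prod_XsubC y0s.
have idmap (q : {poly Qn}) : map_poly \1%VF q = q.
  by rewrite map_polyE map_id_in ?polyseqK // => z _; rewrite id_lfunE.
pose phi := kHomExtend 1 \1 x0 y0.
have homphi : kHom 1 <<1; x0>> phi by rewrite kHomExtendP ?kHom1 ?idmap ?subvv.
have splitp : splittingFieldFor <<1; x0>> (map_poly (in_alg Qn) p) fullv.
  exists s; first by rewrite Dp0 eqpxx.
  apply/eqP; rewrite eqEsubv subvf -genQn /=; apply/Fadjoin_seqP; split; last first.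
    by move=> z; apply: seqv_sub_adjoin.
  by apply: subv_trans (subv_adjoin_seq _ _); apply: sub1v.
have [g homg Dg] := kHom_extends (sub1v _) homphi pover splitp.
have gm : monoid_morphism g by apply/kHom_monoid_morphism; apply: homg.
pose gmM := GRing.isMonoidMorphism.Build _ _ g gm.
pose gRM : {rmorphism _ -> _} := HB.pack (fun_of_lfun g) gmM.
have [nu Dnu] := extend_algC_subfield_aut QnC gRM.
exists nu; rewrite -Dx -Dnu /= -Dg ?memv_adjoin // -Dy; congr (QnC _).
by rewrite /phi (kHomExtend_val (kHom1 1 1)) ?idmap.
Qed.

(** * Galois classes, stable lists and sums over orbits *)

Definition galois_conj (x y : algC) := root (minCpoly x) y.

Lemma galois_conj_refl x : galois_conj x x. Proof. exact: root_minCpoly. Qed.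

Lemma galois_conjE x y : galois_conj x y -> minCpoly y = minCpoly x.
Proof. by case/algC_conjugate=> nu <-; rewrite minCpoly_aut. Qed.

Lemma galois_conj_autr (nu : {rmorphism algC -> algC}) x y : galois_conj x (nu y) =
  galois_conj x y.
Proof.
by apply/idP/idP=> /galois_conjE; rewrite /galois_conj ?minCpoly_aut => <-;
  rewrite ?root_minCpoly // -(minCpoly_aut nu) root_minCpoly.
Qed.

Definition rootsC (p : {poly algC}) : seq algC :=
  sval (closed_field_poly_normal p).

Lemma rootsCE p : p = lead_coef p *: \prod_(z <- rootsC p) ('X - z%:P).
Proof. exact: svalP (closed_field_poly_normal p). Qed.

Lemma rootsC_monic p : p \is monic -> p = \prod_(z <- rootsC p) ('X - z%:P).
Proof. by move=> /monicP mp; rewrite {1}(rootsCE p) mp scale1r. Qed.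

Lemma mem_rootsC p x : p \is monic -> (x \in rootsC p) = root p x.
Proof. by move=> mp; rewrite {2}(rootsC_monic mp) root_prod_XsubC. Qed.

Definition galois_stable (s : seq algC) :=
  forall nu : {rmorphism algC -> algC}, perm_eq (map nu s) s.

Lemma rootsC_map (nu : {rmorphism algC -> algC}) p : p \is monic ->
  perm_eq (map nu (rootsC p)) (rootsC (map_poly nu p)).
Proof.
move=> mp; apply: prod_XsubC_eq; rewrite -rootsC_monic ?map_monic //.
rewrite {2}(rootsC_monic mp) rmorph_prod /= big_map.
by apply: eq_bigr => z _; rewrite map_polyXsubC.
Qed.

Lemma perm_map_filter (nu : {rmorphism algC -> algC}) (P : pred algC) s :
    (forall x, P (nu x) = P x) -> perm_eq (map nu s) s ->
  perm_eq (map nu (filter P s)) (filter P s).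
Proof.
move=> Pnu nu_s; have E : filter P s = filter (preim nu P) s.
  by apply: eq_filter => x; rewrite /= Pnu.
by rewrite {1}E -filter_map; apply: perm_filter.
Qed.

Lemma galois_stable_filter (P : pred algC) s :
    (forall (nu : {rmorphism algC -> algC}) x, P (nu x) = P x) ->
  galois_stable s -> galois_stable (filter P s).
Proof. by move=> Pnu st_s nu; apply: perm_map_filter. Qed.

Lemma count_galois_stable (nu : {rmorphism algC -> algC}) s x :
  galois_stable s -> count_mem (nu x) s = count_mem x s.
Proof.
move=> st_s; rewrite -(permP (st_s nu)) count_map; apply: eq_count => y /=.
by rewrite (inj_eq (fmorph_inj nu)).
Qed.

Definition orbit_sum (F : algC -> algC) x := \sum_(y <- undup (rootsC (minCpoly x))) F y.

(** Automorphisms permute [s], so all conjugates of [x] occur in it equally often. *)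
Lemma sum_galois_conj F s x : galois_stable s ->
  \sum_(y <- s | galois_conj x y) F y = orbit_sum F x *+ count_mem x s.
Proof.
move=> st_s; rewrite /orbit_sum; set o := undup _.
have o_uniq : uniq o by apply: undup_uniq.
have memo y : (y \in o) = galois_conj x y by rewrite mem_undup mem_rootsC ?minCpoly_monic.
transitivity (\sum_(y <- s) \sum_(z <- o | z == y) F z).
  rewrite big_mkcond; apply: eq_bigr => y _; rewrite -memo.
  have [yo | yo] := boolP (y \in o).
    by rewrite -big_filter (filter_pred1_uniq o_uniq) ?big_seq1.
  by rewrite big1_seq // => z /andP[/eqP->]; rewrite (negPf yo).
rewrite (exchange_big_dep predT) //= -sumrMnl !big_seq; apply: eq_bigr => z.
rewrite memo => /algC_conjugate[nu <-].
rewrite -(count_galois_stable nu x st_s) big_const_seq iter_addr_0.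
by congr (_ *+ _); apply: eq_count => y /=; rewrite eq_sym.
Qed.

(** Induction on the size: removing the Galois class of the head leaves a shorter stable list. *)
Lemma galois_stable_sum0 F s : galois_stable s ->
  {in s, forall x, orbit_sum F x = 0} -> \sum_(x <- s) F x = 0.
Proof.
have [n] := ubnP (size s); elim: n s => // n IHn [|x s] lt_s_n st_s F0.
  by rewrite big_nil.
rewrite (bigID (galois_conj x)) /= sum_galois_conj // F0 ?mem_head // mul0rn add0r.
rewrite -big_filter; apply: IHn.
- rewrite /= galois_conj_refl /= -ltnS; apply: leq_trans lt_s_n.
  by rewrite !ltnS size_filter count_size.
- by apply: galois_stable_filter => // nu y; rewrite galois_conj_autr.
by move=> y; rewrite mem_filter => /andP[_ /F0].
Qed.

Lemma galois_stable_orbit_sum0 F s x : galois_stable s -> x \in s ->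
  \sum_(y <- s | galois_conj x y) F y = 0 -> orbit_sum F x = 0.
Proof.
move=> st_s xs /eqP; rewrite sum_galois_conj // mulrn_eq0 -[_ == 0%N]negbK -lt0n.
by rewrite -has_count has_pred1 xs => /eqP.
Qed.

Lemma prod_norm_lt1 (s : seq algC) :
  {in s, forall z, `|z| < 1} -> s != [::] -> `|\prod_(z <- s) z| < 1.
Proof.
elim: s => // z s IHs lt1 _; rewrite big_cons normrM.
have [-> | s0] := eqVneq s [::]; first by rewrite big_nil normr1 mulr1 lt1 ?mem_head.
apply: mulr_ilt1 => //; first by rewrite lt1 ?mem_head.
by apply: IHs => // y ys; rewrite lt1 // inE ys orbT.
Qed.

(** The constant coefficient of the minimal polynomial is an integer and, up to sign, the product of
    the conjugates. Being less than 1 in absolute value it vanishes, so 0 is a conjugate of [a]. *)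
Lemma Aint_conj_lt1 a : a \in Aint ->
  (forall nu : {rmorphism algC -> algC}, `|nu a| < 1) -> a = 0.
Proof.
move=> Za lt1; have Dm := rootsC_monic (minCpoly_monic a).
have: root (minCpoly a) 0; last first.
  by case/algC_conjugate=> nu /eqP; rewrite fmorph_eq0 => /eqP.
rewrite rootE -normr_eq0 -(normr_eq0 `|_|); apply/eqP.
have Z0 : (minCpoly a).[0] \in Num.int by rewrite horner_coef0 (polyOverP Za).
have: `|(minCpoly a).[0]| < 1; last by
  rewrite -[_ < 1]negbK -real_leNgt ?realE ?ler01 ?normr_ge0 //;
  apply: contraNeq; rewrite !normr_eq0; apply: norm_intr_ge1.
rewrite Dm horner_prod.
set r := rootsC _ in Dm *.
have -> : \prod_(z <- r) ('X - z%:P).[0] = \prod_(z <- map -%R r) z.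
  by rewrite big_map; apply: eq_bigr => z _; rewrite !hornerE.
apply: prod_norm_lt1 => [_ /mapP[z zr ->]|].
  rewrite normrN; move: zr; rewrite mem_rootsC ?minCpoly_monic //.
  by case/algC_conjugate=> nu <-.
by case: r Dm (size_minCpoly a) => // ->; rewrite big_nil size_poly1.
Qed.

(** All roots of the minimal polynomial equal [a], so their sum, a rational coefficient up to sign,
    is a positive multiple of [a]. *)
Lemma aut_fixed_Crat a :
  (forall nu : {rmorphism algC -> algC}, nu a = a) -> a \in Crat.
Proof.
move=> fix_a; have Dm := rootsC_monic (minCpoly_monic a).
set r := rootsC _ in Dm; have ra : {in r, forall z, z = a}.
  by move=> z; rewrite mem_rootsC ?minCpoly_monic // => /algC_conjugate[nu <-].
have r0 : size r != 0 by case: r Dm (size_minCpoly a) {ra} => // ->;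
  rewrite big_nil size_poly1.
have := coefPn_prod_XsubC r0; rewrite -Dm => Dc.
have : \sum_(p <- r) p \in Crat.
  rewrite -[X in X \in _]opprK -Dc rpredN.
  by have [p [-> _] _] := minCpolyP a; rewrite coef_map Crat_rat.
rewrite (eq_big_seq (fun=> a)) // big_const_seq iter_addr_0 count_predT => Ca.
rewrite -(@mulfK _ (size r)%:R _ a) ?pnatr_eq0 // mulr_natr.
by rewrite rpred_div // rpred_nat.
Qed.

(** * Factors of the trinomial *)

Implicit Types (p q : {poly algC}) (x y z : algC) (s : seq algC).

Definition geo k (x : algC) := \sum_(i < k.+1) x ^+ i.

Definition trinom k (z : algC) : {poly algC} := 'X^(k.+1) - z *: 'X + (z - 1)%:P.

Lemma trinomE k z x : (trinom k z).[x] = (x - 1) * (geo k x - z).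
Proof.
by rewrite /geo mulrBr -subrX1 /trinom !(hornerD, hornerN, hornerZ, hornerXn,
  hornerX, hornerC); ring.
Qed.

Lemma size_trinom k z : (0 < k)%N -> size (trinom k z) = k.+2.
Proof.
move=> k_gt0; rewrite /trinom -addrA size_polyDl ?size_polyXn // ltnS.
apply: leq_trans (size_polyD _ _) _; rewrite size_polyN geq_max.
rewrite (leq_trans (size_scale_leq _ _)) ?size_polyX //.
by rewrite (leq_trans (size_polyC_leq1 _)).
Qed.

Lemma trinom_monic k z : (0 < k)%N -> trinom k z \is monic.
Proof.
move=> k_gt0; rewrite monicE lead_coefE size_trinom //= !coefE eqxx.
by case: k k_gt0 => // k _; rewrite /= mulr0 subr0 addr0.
Qed.

(* [X^N p^*(1/X)], where [p^*] has the conjugate coefficients. *)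
Definition revp N (p : {poly algC}) : {poly algC} := \poly_(i < N.+1) (p`_(N - i))^*.

Lemma horner_revp N p x : (size p <= N.+1)%N -> x != 0 ->
  (revp N p).[x] = x ^+ N * (p.[(x^*)^-1])^*.
Proof.
move=> sp x0; rewrite horner_poly (horner_coef_wide _ sp) rmorph_sum mulr_sumr.
rewrite (reindex_inj rev_ord_inj) /=; apply: eq_bigr => i _.
have iN : (i <= N)%N by rewrite -ltnS.
rewrite subSS rmorphM rmorphXn fmorphV /= conjCK subKn // exprVn.
have -> : x ^+ N = x ^+ (N - i) * x ^+ i by rewrite -exprD subnK.
by rewrite mulrCA mulfK ?expf_neq0.
Qed.

Lemma poly_eq_nonzero (p q : {poly algC}) :
  (forall x, x != 0 -> p.[x] = q.[x]) -> p = q.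
Proof.
move=> eqpq; apply/eqP; rewrite -subr_eq0; apply/eqP.
apply: (@roots_geq_poly_eq0 _ _ [seq i.+1%:R | i <- iota 0 (size (p - q))]).
- apply/allP => _ /mapP[i _ ->].
  by rewrite rootE hornerD hornerN eqpq ?subrr ?pnatr_eq0.
- rewrite map_inj_uniq ?iota_uniq // => i j /eqP.
  by rewrite eqr_nat => /eqP[].
by rewrite size_map size_iota.
Qed.

Lemma revpM a b p q : (size p <= a.+1)%N -> (size q <= b.+1)%N ->
  revp (a + b) (p * q) = revp a p * revp b q.
Proof.
move=> sp sq; apply: poly_eq_nonzero => x x0.
have spq : (size (p * q)%R <= (a + b).+1)%N.
  apply: leq_trans (size_polyMleq _ _) _; move: sp sq; lia.
rewrite hornerM !horner_revp // hornerM rmorphM exprD; ring.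
Qed.

Lemma size_revp N p : (size (revp N p) <= N.+1)%N.
Proof. exact: size_poly. Qed.

Lemma coef_revp N p i : (i <= N)%N -> (revp N p)`_i = (p`_(N - i))^*.
Proof. by move=> iN; rewrite coef_poly ltnS iN. Qed.

Lemma revpK N p : (size p <= N.+1)%N -> revp N (revp N p) = p.
Proof.
move=> sp; apply/polyP=> i; rewrite coef_poly ltnS; case: leqP => iN.
  by rewrite coef_revp ?leq_subr // conjCK subKn.
by rewrite nth_default // (leq_trans sp).
Qed.

(** The coefficients of p p^* are the autocorrelations of the coefficients of p, which is the form
    in which G G^* = f f^* is exploited. *)
Lemma coef_mul_revp N p t : (t <= N)%N ->
  (p * revp N p)`_t = \sum_(i < t.+1) p`_i * (p`_(N - t + i))^*.
Proof.
move=> tN; rewrite coefM; apply: eq_bigr => i _.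
have it : (i <= t)%N by rewrite -ltnS.
rewrite coef_revp ?(leq_trans (leq_subr _ _)) //.
by congr (_ * (_`__)^*); lia.
Qed.

Lemma unity_conjC (z : algC) m : (0 < m)%N -> z ^+ m = 1 -> z^* = z^-1.
Proof.
move=> m_gt0 zm; have z1 : `|z| = 1.
  by apply/eqP; rewrite -(@pexpr_eq1 _ _ m) // -normrX zm normr1.
by rewrite invC_norm z1 expr1n invr1 mul1r.
Qed.

(* [c] belongs to [Q(z)]; for a root of unity [z] this is a CM field, so that
   complex conjugation commutes with all embeddings. *)
Definition fixes z c := forall tau : {rmorphism algC -> algC}, tau z = z -> tau c = c.

Lemma fixes_conjC z c m : (0 < m)%N -> z ^+ m = 1 -> fixes z c -> fixes z c^*.
Proof.
move=> m_gt0 zm fc tau tz; have zV := unity_conjC m_gt0 zm.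
have E : (tau c^*)^* = c.
  apply: (fc (Num.conj \o tau \o Num.conj : {rmorphism algC -> algC})).
  by rewrite /= zV fmorphV tz -zV conjCK.
by rewrite -{2}E conjCK.
Qed.

(** Conjugation inverts roots of unity, so the commutator of [nu] and conjugation fixes [z], hence
    also [c]. *)
Lemma fixes_aut_conjC z c m (nu : {rmorphism algC -> algC}) :
  (0 < m)%N -> z ^+ m = 1 -> fixes z c -> nu c^* = (nu c)^*.
Proof.
move=> m_gt0 zm fc; have zV := unity_conjC m_gt0 zm.
have nzV : (nu z)^* = (nu z)^-1 by apply: (@unity_conjC _ m) => //;
  rewrite -rmorphXn zm rmorph1.
have E : algC_invaut nu (nu c^*)^* = c.
  pose tau := (algC_invaut nu \o Num.conj \o nu \o Num.conj : {rmorphism algC -> algC}).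
  by apply: (fc tau); rewrite /tau /= zV !fmorphV /= nzV fmorphV /= invrK algC_autK.
by have := congr1 nu E; rewrite algC_invautK => <-; rewrite conjCK.
Qed.

(** The second equation is the reversed trinomial at [x], for [z] of modulus 1. Together they force
    x^k = z^2 and z x = -1. *)
Lemma trinom_common_root k z x : z != 0 -> z != 1 -> x != 1 ->
    x ^+ k.+1 - z * x + (z - 1) = 0 ->
    1 - z^-1 * x ^+ k + (z^-1 - 1) * x ^+ k.+1 = 0 ->
  x ^+ k.+2 = 1.
Proof.
move=> z0 z1 x1; rewrite !exprSr; set X := x ^+ k => E1 E2.
have XE : X = z ^+ 2.
  have : (X - z ^+ 2) * (x - 1) = 0.
    have -> : (X - z ^+ 2) * (x - 1) =
      z * (X * x - z * x + (z - 1)) + z * (1 - z^-1 * X + (z^-1 - 1) * (X * x)).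
      by field.
    by rewrite E1 E2 !mulr0 addr0.
  by move/eqP; rewrite mulf_eq0 !subr_eq0 (negPf x1) orbF => /eqP.
have zx : z * x = -1.
  have : (z * x + 1) * (z - 1) = 0 by rewrite -[RHS]E1 XE; ring.
  by move/eqP; rewrite mulf_eq0 subr_eq0 (negPf z1) orbF addr_eq0 => /eqP.
have -> : X * x * x = (z * x) ^+ 2 by rewrite XE; ring.
by rewrite zx sqrrN expr1n.
Qed.

(* With [t = |w - 1| < 2], AM-GM bounds [|c|^2 + |e|^2] below by [2 t], which
   leaves at most [2 + t^2 - 2 t < 2] for [|a|^2 + |b|^2]. *)
Lemma norm_mid_lt1 (w a b c e : algC) : w * w^* = 1 -> w != 1 -> w != -1 ->
    c * e^* = w - 1 ->
    `|a| ^+ 2 + `|b| ^+ 2 + `|c| ^+ 2 + `|e| ^+ 2 <= 4 - w - w^* ->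
  `|a * b| < 1.
Proof.
move=> ww w1 wN1 ce le4; pose s := `|w - 1|.
have s2 : s ^+ 2 = 2 - w - w^*.
  rewrite normCK rmorphB rmorph1 mulrBl mulrBr ww; ring.
have s_gt0 : 0 < s by rewrite normr_gt0 subr_eq0.
have s_lt2 : 0 < 2 - s.
  rewrite subr_gt0 -(ltr_pXn2r (n := 2)) ?nnegrE ?normr_ge0 // s2 -subr_gt0.
  have -> : 2 ^+ 2 - (2 - w - w^*) = `|w + 1| ^+ 2.
    rewrite normCK rmorphD rmorph1 mulrDl mulrDr ww; ring.
  by rewrite exprn_gt0 // normr_gt0 addr_eq0.
have CE : `|c| * `|e| = s by rewrite -(norm_conjC e) -normrM ce.
have sq_ge0 x y : 0 <= (`|x| - `|y|) ^+ 2 by rewrite -realEsqr rpredB ?normr_real.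
rewrite normrM -subr_gt0 -(pmulr_lgt0 _ (ltr0Sn _ 1)).
set A := `|a| in le4 *; set B := `|b| in le4 *.
set C := `|c| in le4 CE *; set D := `|e| in le4 CE *.
have -> : (1 - A * B) * 2 = (4 - w - w^* - (A ^+ 2 + B ^+ 2 + C ^+ 2 + D ^+ 2))
   + (A - B) ^+ 2 + (C - D) ^+ 2 + s * (2 - s).
  have -> : s * (2 - s) = 2 * (C * D) - s ^+ 2 by rewrite CE; ring.
  by rewrite s2; ring.
apply: ltr_wpDl; last exact: mulr_gt0.
by apply: addr_ge0 (sq_ge0 c e); apply: addr_ge0 (sq_ge0 a b); rewrite subr_ge0.
Qed.

Lemma sum_ge_four (N a b : nat) (F : nat -> algC) : (0 < a < b)%N -> (b < N)%N ->
    (forall i, 0 <= F i) ->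
  F a + F b + F 0%N + F N <= \sum_(i < N.+1) F i.
Proof.
move=> /andP[a0 ab] bN F0; pose r := [:: a; b; 0%N; N].
rewrite -(big_mkord xpredT F) (bigID (mem r)) /= -big_filter.
rewrite (perm_big r); last first.
  apply: uniq_perm; first by rewrite filter_uniq ?iota_uniq.
    by rewrite /= !inE; lia.
  by move=> i; rewrite mem_filter mem_index_iota /= !inE; lia.
have -> : \sum_(i <- r) F i = F a + F b + F 0%N + F N.
  by rewrite !big_cons big_nil addr0 !addrA.
by rewrite lerDl sumr_ge0.
Qed.

(* The product of two middle coefficients has absolute value less than 1 in every
   embedding, hence is 0.  For [z = -1] the coefficients are integers. *)
Lemma mid_coef_mul0 N a b m z p : (0 < m)%N -> z ^+ m = 1 -> z != 1 ->
    (forall i, fixes z p`_i) -> (forall i, p`_i \in Aint) ->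
    \sum_(i < N.+1) p`_i * (p`_i)^* = 4 - z - z^* -> p`_0 * (p`_N)^* = z - 1 ->
  (0 < a < b)%N -> (b < N)%N -> p`_a * p`_b = 0.
Proof.
move=> m_gt0 zm z1 fix_p Zp norm_p end_p ab bN.
have [zN1 | zN1] := eqVneq z (-1).
  have Cp i : `|p`_i| \in Num.nat.
    rewrite natr_norm_int // Cint_rat_Aint //; apply: aut_fixed_Crat => nu.
    by apply: fix_p; rewrite zN1 rmorphN1.
  apply/eqP/negPn/negP; rewrite mulf_eq0 negb_or => /andP[a0 b0].
  have := sum_ge_four (F := fun i => `|p`_i| ^+ 2) ab bN (fun i =>
    exprn_ge0 2 (normr_ge0 _)).
  have -> : \sum_(i < N.+1) `|p`_i| ^+ 2 = 6.
    under eq_bigr do rewrite normCK.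
    by rewrite norm_p zN1 rmorphN1; ring.
  have := congr1 (fun c => `|c|) end_p; rewrite normrM norm_conjC zN1.
  have -> : `|-1 - 1| = 2 :> algC by rewrite -opprD normrN -mulr2n normr_nat.
  move: a0 b0; rewrite -(normr_eq0 p`_a) -(normr_eq0 p`_b).
  have /natrP[A ->] := Cp a; have /natrP[B ->] := Cp b.
  have /natrP[C ->] := Cp 0%N; have /natrP[D ->] := Cp N.
  rewrite !pnatr_eq0 -!natrX -natrM -!natrD ler_nat => A0 B0 /eqP.
  rewrite eqr_nat => /eqP CD le6.
  (* The end coefficients have absolute values 1 and 2, whose squares use up 5 of the total 6; two
     nonzero middle integers do not fit. *)
  have C2 : (C <= 2)%N by rewrite -CD leq_pmulr //; case: D CD {le6} => //; rewrite muln0.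
  have A1 : (0 < A ^ 2)%N by rewrite expn_gt0 lt0n A0.
  have B1 : (0 < B ^ 2)%N by rewrite expn_gt0 lt0n B0.
  have [C1 | {}C2] : C = 1%N \/ C = 2%N.
    by case: C CD C2 {le6} => [|[|[|]]] // _ _; [left | right].
    have D2 : D = 2%N by lia.
    by move: le6; rewrite C1 D2; lia.
  have D1 : D = 1%N by lia.
  by move: le6; rewrite C2 D1; lia.
apply: Aint_conj_lt1 => [|nu]; first by rewrite rpredM.
rewrite rmorphM; apply: (@norm_mid_lt1 (nu z) _ _ (nu p`_0) (nu p`_N)).
- rewrite (@unity_conjC _ m) ?divff //; last by rewrite -rmorphXn zm rmorph1.
  by rewrite fmorph_eq0; apply: contra_eq_neq zm => ->;
    rewrite expr0n gtn_eqF // eq_sym oner_eq0.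
- by rewrite -(rmorph1 nu) (inj_eq (fmorph_inj nu)).
- by rewrite -(rmorphN1 nu) (inj_eq (fmorph_inj nu)).
- by rewrite -(fixes_aut_conjC nu m_gt0 zm (fix_p N)) -rmorphM end_p rmorphB rmorph1.
have zzc : fixes z z by [].
rewrite -(fixes_aut_conjC nu m_gt0 zm zzc) -(rmorph_nat nu 4) -!rmorphB -norm_p rmorph_sum.
apply: le_trans (sum_ge_four (F := fun i => `|nu p`_i| ^+ 2) ab bN (fun i =>
  exprn_ge0 2 (normr_ge0 _))) _.
rewrite le_eqVlt; apply/orP; left; apply/eqP; apply: eq_bigr => i _.
by rewrite normCK rmorphM (fixes_aut_conjC nu m_gt0 zm (fix_p i)).
Qed.

Lemma horner_three N j p x : (size p <= N.+1)%N -> (0 < j < N)%N ->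
    (forall i, (0 < i < N)%N -> i != j -> p`_i = 0) ->
  p.[x] = p`_0 + p`_j * x ^+ j + p`_N * x ^+ N.
Proof.
move=> sp /andP[j0 jN] p0.
have E : p = (p`_0)%:P + p`_j *: 'X^j + p`_N *: 'X^N.
  apply/polyP=> i; rewrite !coefE; have [-> | i0] := eqVneq i 0%N.
    by rewrite (ltn_eqF j0) (ltn_eqF (ltn_trans j0 jN)) !mulr0 !addr0.
  have [-> | ij] := eqVneq i j; first by rewrite !mulr1 (ltn_eqF jN) mulr0 addr0 add0r.
  have [-> | iN] := eqVneq i N; first by rewrite mulr1 mulr0 !add0r.
  rewrite !mulr0 !addr0; have [lt_iN | ge_iN] := ltnP i N.
    by rewrite p0 // lt0n i0.
  by rewrite nth_default // (leq_trans sp) // ltn_neqAle eq_sym iN.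
by rewrite {1}E !(hornerD, hornerZ, hornerXn, hornerC).
Qed.

(** In the autocorrelation of shift 1, the middle term contributes only when it is adjacent to an
    end. *)
Lemma sum_adjacent_three N j p : (0 < j < N)%N -> (2 < N)%N ->
    (forall i, (0 < i < N)%N -> i != j -> p`_i = 0) ->
  \sum_(i < N) p`_i * (p`_i.+1)^* =
    (if j == 1%N then p`_0 * (p`_1)^* else 0)
    + (if j == N.-1 then p`_j * (p`_N)^* else 0).
Proof.
case: N => [|[|N]] // /andP[j0 jN] N1 p0; rewrite big_ord_recl big_ord_recr /=.
rewrite big1 ?add0r => [|i _]; last first.
  rewrite /bump /= !add1n; have [E | ] := eqVneq i.+1 j; last first.
    by move=> ij; rewrite p0 ?mul0r //= !ltnS ltnW.
  by rewrite (p0 i.+2) ?conjC0 ?mulr0 -?E ?ltnS ?gtn_eqF //= ltn_ord.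
rewrite /bump /= add1n; congr (_ + _).
  have [//| j1] := eqVneq j 1%N; by rewrite (p0 1%N) ?conjC0 ?mulr0 //= eq_sym.
by have [-> //| jN1] := eqVneq j N.+1; rewrite (p0 N.+1) ?mul0r //= ?ltnSn // eq_sym.
Qed.

Lemma coef_trinom k z i : (0 < k)%N ->
  (trinom k z)`_i = if i == 0%N then z - 1 else if i == 1%N then - z else (i == k.+1)%:R.
Proof.
case: k => // k _; rewrite !coefE; case: i => [|[|i]] /=.
- by rewrite mulr0 oppr0 !add0r.
- by rewrite mulr1 add0r addr0.
by rewrite mulr0 oppr0 !addr0.
Qed.

Lemma fixes_prod_XsubC z (s : seq algC) i :
    (forall tau : {rmorphism algC -> algC}, tau z = z -> perm_eq (map tau s) s) ->
  fixes z (\prod_(w <- s) ('X - w%:P))`_i.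
Proof.
move=> st tau tz; rewrite -coef_map rmorph_prod /=; congr (polyseq _)`_i.
apply: etrans (perm_big _ (st tau tz)); rewrite big_map.
by apply: eq_bigr => w _; rewrite map_polyXsubC.
Qed.

Lemma Aint_geo_unity k m x : (0 < k)%N -> (0 < m)%N -> geo k x ^+ m = 1 -> x \in Aint.
Proof.
move=> k_gt0 m_gt0 gm; pose g : {poly int} := \poly_(i < k.+1) 1.
have sg : size g = k.+1 by rewrite size_poly_eq ?oner_eq0.
have gE : (map_poly intr g).[x] = geo k x.
  rewrite horner_coef size_map_inj_poly ?sg //; last exact: intr_inj.
  by apply: eq_bigr => i _; rewrite coef_map coef_poly ltn_ord mul1r.
have mg : g \is monic by rewrite monicE lead_coefE sg coef_poly ltnSn.
have lt1 : (size (1 : {poly int})%R < size (g ^+ m))%N.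
  by rewrite size_poly1 -subn_gt0 subn1 size_exp sg muln_gt0 k_gt0.
apply: (@root_monic_Aint (map_poly intr (g ^+ m - 1))).
- by rewrite rootE rmorphB rmorphXn rmorph1 /= hornerD hornerN horner_exp gE gm hornerC
  subrr.
- rewrite monicE lead_coef_map_inj //; last exact: intr_inj.
  by rewrite lead_coefDl ?size_polyN // (monicP (monic_exp m mg)).
by apply/polyOverP=> i; rewrite coef_map /= intr_int.
Qed.

(* Ljunggren's trick: if [x] and [y] were not conjugate, the trinomial [f] would
   split as [p1 * p2] with [x] a root of [p1] and [y] a root of [p2], both stable
   under the automorphisms fixing [z].  As [G = p1^* p2] satisfies
   [G G^* = f f^*], it is itself a trinomial, proportional to [f] or [f^*]. *)
Lemma geo_galois_conj k m z x y : (2 < k)%N -> (0 < m)%N -> z ^+ m = 1 -> z != 1 ->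
    geo k x = z -> geo k y = z -> x ^+ k.+2 != 1 -> y ^+ k.+2 != 1 ->
  galois_conj x y.
Proof.
move=> k2 m_gt0 zm z1 gx gy xk yk; apply/negPn/negP=> nxy.
have k0 : (0 < k)%N by lia.
have N2 : (2 < k.+1)%N by lia.
have oneN : (0 < 1 < k.+1)%N by lia.
have kN : (0 < k < k.+1)%N by lia.
have kn1 : k != 1%N by lia.
have kneN : k != k.+1 by lia.
have k1 : (1 < k)%N by lia.
have zV := unity_conjC m_gt0 zm.
have z0 : z != 0 by apply: contra_eq_neq zm => ->;
  rewrite expr0n gtn_eqF // eq_sym oner_eq0.
pose f := trinom k z; have mf : f \is monic := trinom_monic z k0.
pose l := rootsC f; pose l1 := filter (galois_conj x) l;
  pose l2 := filter (predC (galois_conj x)) l.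
pose p1 : {poly algC} := \prod_(w <- l1) ('X - w%:P).
pose p2 : {poly algC} := \prod_(w <- l2) ('X - w%:P).
have Df : f = p1 * p2.
  rewrite (rootsC_monic mf) -(perm_big _ (permEl (perm_filterC (galois_conj x) l))).
  by rewrite big_cat.
pose a := size l1; pose b := size l2.
have sp1 : size p1 = a.+1 by rewrite size_prod_XsubC.
have sp2 : size p2 = b.+1 by rewrite size_prod_XsubC.
have sf : size f = k.+2 by rewrite size_trinom.
have ab : (a + b = k.+1)%N.
  by rewrite /a /b !size_filter count_predC; have := size_prod_XsubC l id;
    rewrite -rootsC_monic // sf => -[].
pose G := revp a p1 * p2.
have sG : (size G <= k.+2)%N.
  apply: leq_trans (size_polyMleq _ _) _; have := size_revp a p1; rewrite sp2; lia.
have GG : G * revp k.+1 G = f * revp k.+1 f.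
  rewrite /G -ab (revpM (size_revp _ _)) ?sp2 // revpK ?sp1 // Df revpM ?sp1 ?sp2 //.
  ring.
have corr t : (t <= k.+1)%N ->
    \sum_(i < t.+1) G`_i * (G`_(k.+1 - t + i))^* = \sum_(i < t.+1) f`_i * (f`_(k.+1 - t
      + i))^*.
  by move=> tk; rewrite -!coef_mul_revp // GG.
have memf w : (w \in l) = (w == 1) || (geo k w == z).
  by rewrite mem_rootsC // rootE trinomE mulf_eq0 !subr_eq0.
have l_fix (tau : {rmorphism algC -> algC}) : tau z = z -> perm_eq (map tau l) l.
  move=> tz; rewrite -[X in perm_eq _ X](_ : rootsC (map_poly tau f) = _);
    first exact: rootsC_map.
  congr rootsC; rewrite /f /trinom !(rmorphD, rmorphN) /= map_polyXn map_polyZ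
    map_polyX map_polyC /= tz.
  by rewrite map_polyC /= rmorph1.
have fix1 i : fixes z p1`_i.
  apply: fixes_prod_XsubC => tau tz; apply: perm_map_filter (l_fix _ tz).
  by move=> w; rewrite galois_conj_autr.
have fix2 i : fixes z p2`_i.
  apply: fixes_prod_XsubC => tau tz; apply: perm_map_filter (l_fix _ tz).
  by move=> w; rewrite /= galois_conj_autr.
have fixG i : fixes z G`_i.
  move=> tau tz; rewrite coefM rmorph_sum; apply: eq_bigr => j _.
  rewrite rmorphM (fix2 _ tau) // coef_poly; congr (_ * _).
  by case: ifP => _; rewrite ?rmorph0 // (fixes_conjC m_gt0 zm (fix1 _)).
have Zl w : w \in l -> w \in Aint.
  rewrite memf => /orP[/eqP-> | /eqP gw]; first exact: rpred1.
  by apply: (Aint_geo_unity k0 m_gt0); rewrite gw.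
have ZG i : G`_i \in Aint.
  have Zprod (s : seq algC) : {subset s <= l} ->
    \prod_(w <- s) ('X - w%:P) \is a polyOver Aint.
    move=> sl; rewrite big_seq rpred_prod // => w ws.
    by rewrite polyOverXsubC Zl ?sl.
  have Z1 : p1 \is a polyOver Aint by apply: Zprod => w; rewrite mem_filter => /andP[].
  have Z2 : p2 \is a polyOver Aint by apply: Zprod => w; rewrite mem_filter => /andP[].
  rewrite coefM rpred_sum // => j _; rewrite rpredM ?(polyOverP Z2) //.
  rewrite coef_poly; case: ifP => _; rewrite ?rpred0 //.
  by rewrite (Aint_aut Num.conj) (polyOverP Z1).
have f0 : f`_0 = z - 1 by rewrite coef_trinom.
have f1 : f`_1 = - z by rewrite coef_trinom.
have fN : f`_k.+1 = 1 by rewrite coef_trinom // eqxx /= eqSS gtn_eqF.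
have fi i : (1 < i)%N -> i != k.+1 -> f`_i = 0.
  by move=> i1 iN; rewrite coef_trinom // (negPf iN) (gtn_eqF i1) gtn_eqF // ltnW.
have normG : \sum_(i < k.+2) G`_i * (G`_i)^* = 4 - z - z^*.
  have := corr k.+1 (leqnn _); rewrite subnn.
  under eq_bigr do rewrite add0n; move->; under eq_bigr do rewrite add0n.
  rewrite big_ord_recl big_ord_recr; case: (k) k0 fi fN => // k' _ fi fN.
  rewrite big_ord_recl big1 => [|i _]; last first.
    by rewrite fi ?mul0r //= /bump /=; have := ltn_ord i; lia.
  rewrite /bump /= f0 f1 fN rmorphB rmorphN rmorph1 /= conjC1 zV.
  by field.
have eq0 : G`_0 * (G`_k.+1)^* = z - 1.
  by have := corr 0%N isT; rewrite !big_ord1 subn0 addn0 f0 fN rmorph1 mulr1.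
have eq1 : G`_0 * (G`_k)^* + G`_1 * (G`_k.+1)^* = - z.
  have := corr 1%N isT; rewrite !big_ord_recl !big_ord0 !addr0 /bump /= subSS subn0
    addn0 addn1 f1 fN => ->.
  by rewrite (fi k) // conjC0 mulr0 add0r rmorph1 mulr1.
have eqk : \sum_(i < k.+1) G`_i * (G`_i.+1)^* = z^-1 - 1.
  have := corr k (leqnSn _); rewrite subSn // subnn.
  under eq_bigr do rewrite add1n; move->; under eq_bigr do rewrite add1n.
  rewrite (@sum_adjacent_three _ 1) //.
    rewrite eqxx f0 f1 [(1 == k.+1.-1)%N]ltn_eqF ?(ltnW k2) // addr0 rmorphN /= zV.
    by field.
  move=> i /andP[i0 iN] i1; apply: fi; last by rewrite ltn_eqF.
  by rewrite ltn_neqAle eq_sym i1.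
have mid i j : (0 < i < k.+1)%N -> (0 < j < k.+1)%N -> i != j -> G`_i != 0 -> G`_j = 0.
  have mid' u v : (0 < u < v)%N -> (v < k.+1)%N -> G`_u * G`_v = 0.
    exact: (mid_coef_mul0 m_gt0 zm z1 fixG ZG normG eq0).
  move=> /andP[i0 iN] /andP[j0 jN]; rewrite neq_ltn => /orP[] lt_ij Gi; apply/eqP.
    by have /eqP := mid' i j (introT andP (conj i0 lt_ij)) jN; rewrite mulf_eq0 (negPf Gi).
  by have /eqP := mid' j i (introT andP (conj j0 lt_ij)) iN;
    rewrite mulf_eq0 (negPf Gi) orbF.
have x1 : x != 1 by apply: contraNneq xk => ->; rewrite expr1n.
have y1 : y != 1 by apply: contraNneq yk => ->; rewrite expr1n.
have trE w : geo k w = z -> w ^+ k.+1 - z * w + (z - 1) = 0.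
  move=> gw; have := trinomE k z w; rewrite gw subrr mulr0 => <-.
  by rewrite !(hornerD, hornerN, hornerZ, hornerXn, hornerX, hornerC).
have GN0 : G`_k.+1 != 0.
  by apply: contra_eq_neq eq0 => ->; rewrite conjC0 mulr0 eq_sym subr_eq0.
have z10 : z^-1 - 1 != 0 by rewrite subr_eq0 invr_eq1.
(* By [eq1] the surviving middle coefficient has index k or 1. If it is k, then G is proportional to
   f^*, and the root y of p2 becomes a common root of f and f^*. *)
have [G1 | G1] := eqVneq G`_1 0.
  have Gk : G`_k != 0.
    apply: contra_eq_neq eq1 => ->; rewrite G1 conjC0 mulr0 mul0r addr0.
    by rewrite eq_sym oppr_eq0.
  have Gi i : (0 < i < k.+1)%N -> i != k -> G`_i = 0.
    by move=> iN ik; apply: (mid k i) => //; rewrite ?ltnSn ?andbT // eq_sym.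
  have Gy : G.[y] = 0.
    rewrite /G hornerM [p2.[y]](_ : _ = 0) ?mulr0 //; apply/eqP.
    by rewrite -rootE root_prod_XsubC mem_filter /= nxy memf gy eqxx orbT.
  have := eqk; rewrite (@sum_adjacent_three _ k) //.
  rewrite [(k == 1)%N]gtn_eqF ?(ltnW k2) // eqxx add0r => eqk'.
  move: eq1; rewrite G1 mul0r addr0 => eq1.
  have n0 : G`_0 * (G`_0)^* = 1.
    have eq1' : (G`_0)^* * G`_k = - z^-1 by rewrite -zV -[G`_k]conjCK -rmorphM eq1 rmorphN.
    apply: (mulfI z10); rewrite mulr1 -{1}eqk'.
    transitivity ((G`_0)^* * G`_k * (G`_0 * (G`_k.+1)^*)); first by ring.
    by rewrite eq1' eq0; field.
  case/negP: yk; apply/eqP; apply: (trinom_common_root z0 z1 y1 (trE _ gy)).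
  have := Gy; rewrite (horner_three y sG (j := k)) ?ltnSn ?k0 // => Gy'.
  have eq1' : (G`_0)^* * G`_k = - z^-1 by rewrite -zV -[G`_k]conjCK -rmorphM eq1 rmorphN.
  have eq0' : (G`_0)^* * G`_k.+1 = z^-1 - 1.
    by rewrite -zV -[G`_k.+1]conjCK -rmorphM eq0 rmorphB rmorph1.
  transitivity ((G`_0)^* * (G`_0 + G`_k * y ^+ k + G`_k.+1 * y ^+ k.+1)).
    by rewrite !mulrDr !mulrA eq1' eq0' [(G`_0)^* * _]mulrC n0 mulNr.
  by rewrite Gy' mulr0.
(* If it is 1, then G is proportional to f. The inverse of the conjugate of x is a root of p1^*,
   hence of f, so x is a common root of f and f^*. *)
have Gi i : (0 < i < k.+1)%N -> i != 1%N -> G`_i = 0.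
  by move=> iN ik; apply: (mid 1%N i) => //; rewrite eq_sym.
have Gk : G`_k = 0 by apply: Gi.
have xx0 : x != 0.
  by apply: contraNneq z1 => x0; rewrite -gx x0 /geo big_ord_recl big1 ?addr0 ?expr0 //
    => i _; rewrite expr0n.
have xc0 : (x^*)^-1 != 0 by rewrite invr_eq0 fmorph_eq0.
have Gx : G.[(x^*)^-1] = 0.
  rewrite /G hornerM horner_revp ?sp1 // rmorphV ?unitfE ?fmorph_eq0 //= conjCK invrK.
  rewrite [p1.[x]](_ : _ = 0) ?conjC0 ?mulr0 ?mul0r //; apply/eqP.
  by rewrite -rootE root_prod_XsubC mem_filter /= galois_conj_refl memf gx eqxx orbT.
move: eq1; rewrite Gk conjC0 mulr0 add0r => eq1.
have := eqk; rewrite (@sum_adjacent_three _ 1) //.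
rewrite eqxx [(1 == k.+1.-1)%N]ltn_eqF ?(ltnW k2) // addr0 => eqk'.
have eq1' : (G`_1)^* * G`_k.+1 = - z^-1 by rewrite -zV -[G`_k.+1]conjCK -rmorphM eq1
  rmorphN.
have nN : G`_k.+1 * (G`_k.+1)^* = 1.
  apply: (mulfI z10); rewrite mulr1 -{1}eqk'.
  transitivity ((G`_1)^* * G`_k.+1 * (G`_0 * (G`_k.+1)^*)); first by ring.
  by rewrite eq1' eq0; field.
have fx : f.[(x^*)^-1] = 0.
  have := Gx; rewrite (horner_three (x^*)^-1 sG (j := 1%N)) //.
  move=> Gx'; rewrite !(hornerD, hornerN, hornerZ, hornerXn, hornerX, hornerC).
  set w := (x^*)^-1 in Gx' *.
  transitivity ((G`_k.+1)^* * (G`_0 + G`_1 * w ^+ 1 + G`_k.+1 * w ^+ k.+1)).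
    rewrite !mulrDr !mulrA ![(G`_k.+1)^* * _]mulrC eq0 eq1 nN mul1r expr1 mulNr.
    by rewrite addrC -[RHS]addrA; congr (_ + _); rewrite addrC.
  by rewrite Gx' mulr0.
case/negP: xk; apply/eqP; apply: (trinom_common_root z0 z1 x1 (trE _ gx)).
have : (revp k.+1 f).[x] = 0 by rewrite horner_revp ?sf // fx conjC0 mulr0.
rewrite horner_revp ?sf // => E; rewrite -[RHS]E.
rewrite !(hornerD, hornerN, hornerZ, hornerXn, hornerX, hornerC).
rewrite !(rmorphD, rmorphN, rmorphM, rmorphXn, rmorph1) /= !rmorphV ?unitfE ?fmorph_eq0
  //= conjCK zV.
rewrite !exprS !exprVn; field; rewrite ?xx0 ?z0 ?expf_neq0 //.
Qed.

(** * Power sums *)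

Lemma deriv_prod_XsubC (s : seq algC) (P := \prod_(w <- s) ('X - w%:P)) :
  P^`() = \sum_(w <- s) P %/ ('X - w%:P).
Proof.
rewrite {}/P; elim: s => [|a s IHs]; first by rewrite !big_nil derivC.
rewrite !big_cons mulKp ?polyXsubC_eq0 // derivM derivXsubC mul1r IHs.
congr (_ + _); rewrite mulr_sumr big_seq [RHS]big_seq; apply: eq_bigr => w ws.
by rewrite divp_mulA // dvdp_XsubCl root_prod_XsubC.
Qed.

Definition geo_poly k z : {poly algC} := \poly_(i < k.+1) 1 - z%:P.

Lemma horner_geo_poly k z x : (geo_poly k z).[x] = geo k x - z.
Proof.
rewrite hornerD hornerN hornerC horner_poly; congr (_ - _).
by apply: eq_bigr => i _; rewrite mul1r.
Qed.

Lemma size_geo_poly k z : (0 < k)%N -> size (geo_poly k z) = k.+1.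
Proof.
move=> k0; have s1 : size (\poly_(i < k.+1) (1 : algC)) = k.+1 by rewrite size_poly_eq
  ?oner_eq0.
by rewrite size_polyDl s1 // size_polyN (leq_ltn_trans (size_polyC_leq1 _)).
Qed.

Lemma geo_poly_monic k z : (0 < k)%N -> geo_poly k z \is monic.
Proof.
move=> k0; rewrite monicE lead_coefE size_geo_poly //= coefB coef_poly ltnSn coefC.
by rewrite gtn_eqF // subr0.
Qed.

Lemma trinom_geo_poly k z : trinom k z = ('X - 1%:P) * geo_poly k z.
Proof.
apply: poly_eq_nonzero => x _.
by rewrite trinomE hornerM horner_geo_poly hornerXsubC.
Qed.

(** Newton's identity for the trinomial f: its derivative is the sum of the quotients f / (X - w),
    whose coefficients at X^(k-t) are w^t, while that of the derivative is 0. The extra root 1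
    accounts for the value -1. *)
Lemma sum_rootsC_geo_poly k z t : (0 < t < k)%N ->
  \sum_(w <- rootsC (geo_poly k z)) w ^+ t = -1.
Proof.
move=> /andP[t0 tk]; have k0 := ltn_trans t0 tk.
pose s := 1 :: rootsC (geo_poly k z).
have Ds : trinom k z = \prod_(w <- s) ('X - w%:P).
  by rewrite big_cons -rootsC_monic ?geo_poly_monic // trinom_geo_poly.
suff: \sum_(w <- s) w ^+ t = 0 by rewrite big_cons expr1n => /eqP;
  rewrite addrC addr_eq0 => /eqP.
have := congr1 (fun p : {poly algC} => p`_(k - t)) (deriv_prod_XsubC s).
rewrite -Ds coef_deriv coef_trinom //= coef_sum.
have -> : (k - t).+1 == 1%N = false by lia.
have -> : (k - t).+1 == k.+1 = false by lia.
rewrite mul0rn => E; rewrite [RHS]E big_seq [RHS]big_seq; apply: eq_bigr => w ws.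
pose Q : {poly algC} := \sum_(i < k.+1) 'X^(k - i) * (w ^+ i)%:P - z%:P.
have DQ : trinom k z = Q * ('X - w%:P).
  have wr : (trinom k z).[w] = 0 by apply/eqP; rewrite -rootE Ds root_prod_XsubC.
  transitivity (trinom k z - (trinom k z).[w]%:P); first by rewrite wr subr0.
  rewrite [in RHS]mulrC mulrBr.
  transitivity ('X^(k.+1) - (w%:P) ^+ k.+1 - ('X - w%:P) * z%:P).
    rewrite !(hornerD, hornerN, hornerZ, hornerXn, hornerX, hornerC) /trinom.
    rewrite !(polyCD, polyCN, polyCM, polyC_exp) -mul_polyC; ring.
  rewrite subrXX; congr (_ * _ - _); apply: eq_bigr => i _.
  by rewrite polyC_exp.
rewrite DQ mulpK ?polyXsubC_eq0 // coefB coefC.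
have -> : (k - t == 0)%N = false by lia.
have tk1 : (t < k.+1)%N by lia.
rewrite subr0 coef_sum (bigD1 (Ordinal tk1)) //= big1 => [|i /eqP it].
  by rewrite mulrC coefCM coefXn eqxx mulr1 addr0.
rewrite mulrC coefCM coefXn; have -> : (k - t == k - i)%N = false; last by rewrite mulr0.
apply/eqP => ki; apply: it; apply/val_inj => /=; have := ltn_ord i; lia.
Qed.

Lemma size_rootsC_geo_poly k z : (0 < k)%N -> size (rootsC (geo_poly k z)) = k.
Proof.
move=> k0; have := size_prod_XsubC (rootsC (geo_poly k z)) id.
by rewrite -rootsC_monic ?geo_poly_monic // size_geo_poly // => -[].
Qed.

Lemma galois_stable_poly (s : seq algC) (P := \prod_(w <- s) ('X - w%:P)) :
    (forall nu : {rmorphism algC -> algC}, map_poly nu P = P) ->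
  galois_stable s.
Proof.
move=> nuP nu; apply: prod_XsubC_eq; rewrite -[RHS](nuP nu) rmorph_prod /= big_map.
by apply: eq_bigr => w _; rewrite map_polyXsubC.
Qed.

Lemma mem_conjugates x y : (y \in undup (rootsC (minCpoly x))) = galois_conj x y.
Proof. by rewrite mem_undup mem_rootsC ?minCpoly_monic. Qed.

Lemma galois_stable_conjugates x : galois_stable (undup (rootsC (minCpoly x))).
Proof.
move=> nu; apply: uniq_perm; rewrite ?undup_uniq ?(map_inj_uniq (fmorph_inj nu)) //.
  exact: undup_uniq.
move=> y; rewrite mem_conjugates; apply/mapP/idP => [[w] | xy].
  by rewrite mem_conjugates => xw ->; rewrite galois_conj_autr.
exists (algC_invaut nu y); last by rewrite algC_invautK.
by rewrite mem_conjugates -(galois_conj_autr nu) algC_invautK.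
Qed.

Lemma geo_aut (nu : {rmorphism algC -> algC}) k x : nu (geo k x) = geo k (nu x).
Proof. by rewrite rmorph_sum; apply: eq_bigr => i _; rewrite rmorphXn. Qed.

(** An orbit sum of powers is fixed by every automorphism, in particular by one that raises M-th
    roots of unity to the power [t]. *)
Lemma orbit_sum_unity M j j' t x : (0 < M)%N -> x ^+ M = 1 -> coprime t M ->
    (t * j = j' %[mod M])%N ->
  orbit_sum (fun y => y ^+ j) x = orbit_sum (fun y => y ^+ j') x.
Proof.
move=> M0 xM cotM tj; have [nu nuE] := Qn_aut_exists cotM.
have -> : orbit_sum (fun y => y ^+ j) x = nu (orbit_sum (fun y => y ^+ j) x).
  rewrite /orbit_sum rmorph_sum -(perm_big _ (galois_stable_conjugates x nu)) big_map.
  by apply: eq_bigr => y _; rewrite rmorphXn.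
rewrite /orbit_sum rmorph_sum big_seq [RHS]big_seq; apply: eq_bigr => y.
rewrite mem_conjugates => /algC_conjugate[mu <-].
have muM : mu x ^+ M = 1 by rewrite -rmorphXn xM rmorph1.
by rewrite rmorphXn nuE // -exprM -(expr_mod _ muM) tj expr_mod.
Qed.

(** Over the roots of q(y) = w, for all conjugates w of z = q(x), the total of [F] is 0. The orbits
    of (k+2)-th roots of unity contribute 0, and all other roots form the single orbit of [x]. *)
Lemma orbit_sum_geo F k m x : (2 < k)%N -> (0 < m)%N -> geo k x ^+ m = 1 -> geo k x != 1 ->
    (forall z, \sum_(w <- rootsC (geo_poly k z)) F w = 0) ->
    (forall y, galois_conj (geo k x) (geo k y) -> y ^+ k.+2 = 1 -> orbit_sum F y = 0) ->
  orbit_sum F x = 0.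
Proof.
move=> k2 m0; set z := geo k x => zm z1 F0 Funity.
have k0 : (0 < k)%N by lia.
have [xk|xk] := eqVneq (x ^+ k.+2) 1; first by apply: Funity; rewrite ?galois_conj_refl.
pose zs := undup (rootsC (minCpoly z)).
pose Fs := flatten [seq rootsC (geo_poly k w) | w <- zs].
have prodFs : \prod_(w <- Fs) ('X - w%:P) = \prod_(w <- zs) geo_poly k w.
  by rewrite big_flatten big_map; apply: eq_bigr => w _;
    rewrite -rootsC_monic ?geo_poly_monic.
have st_Fs : galois_stable Fs.
  apply: galois_stable_poly => nu; rewrite prodFs rmorph_prod.
  rewrite -[RHS](perm_big _ (galois_stable_conjugates z nu)) big_map.
  apply: eq_bigr => w _; rewrite /= /geo_poly rmorphB /= map_polyC; congr (_ - _).
  by apply/polyP=> i; rewrite coef_map !coef_poly; case: ifP => _;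
    [apply: rmorph1 | apply: rmorph0].
have memFs y : (y \in Fs) = galois_conj z (geo k y).
  rewrite -mem_conjugates -/zs; apply/flatten_mapP/idP => [[w wz] | yz].
    by rewrite mem_rootsC ?geo_poly_monic // rootE horner_geo_poly subr_eq0 => /eqP->.
  by exists (geo k y); rewrite // mem_rootsC ?geo_poly_monic // rootE horner_geo_poly subrr.
have sumFs : \sum_(y <- Fs) F y = 0.
  by rewrite big_flatten big_map big1.
apply: (galois_stable_orbit_sum0 st_Fs); first by rewrite memFs galois_conj_refl.
apply/eqP; have /eqP := sumFs; rewrite (bigID (galois_conj x)) /= -[X in _ + X]big_filter.
rewrite [X in _ + X](_ : _ = 0) ?addr0 //; apply: galois_stable_sum0.
  by apply: galois_stable_filter => // nu y; rewrite galois_conj_autr.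
move=> y; rewrite mem_filter memFs => /andP[nxy zy]; apply: Funity => //.
(* The inverse of [nu] moves y into the fibre of q over z, where [geo_galois_conj] applies. *)
apply/eqP; apply: contraNT nxy => yk; have [nu nuz] := algC_conjugate zy.
rewrite -[y](algC_invautK nu) galois_conj_autr; apply: (geo_galois_conj k2 m0 zm z1) => //.
  by apply: (fmorph_inj nu); rewrite geo_aut algC_invautK.
by rewrite -(inj_eq (fmorph_inj nu)) rmorphXn /= algC_invautK rmorph1.
Qed.

Lemma geo_sum0 F k s : (2 < k)%N -> galois_stable s ->
    {in s, forall x, exists2 m, (0 < m)%N & geo k x ^+ m = 1} ->
    (forall z, \sum_(w <- rootsC (geo_poly k z)) F w = 0) ->
    {in s, forall x, geo k x = 1 -> orbit_sum F x = 0} ->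
    {in s, forall x y, geo k y != 1 -> galois_conj (geo k x) (geo k y) ->
      y ^+ k.+2 = 1 -> orbit_sum F y = 0} ->
  \sum_(x <- s) F x = 0.
Proof.
move=> k2 st_s unity F0 F1 Fk; apply: galois_stable_sum0 => // x xs.
have [m m0 xm] := unity x xs; have [x1 | x1] := eqVneq (geo k x) 1; first exact: F1.
apply: (orbit_sum_geo k2 m0 xm x1 F0) => y gxy; apply: (Fk x) => //.
apply: contraNneq x1 => y1; have [nu nux] := algC_conjugate gxy.
by rewrite -(inj_eq (fmorph_inj nu)) nux y1 rmorph1.
Qed.

Lemma geo_eq1 k x : (0 < k)%N -> geo k x = 1 -> x = 0 \/ x ^+ k = 1.
Proof.
case: k => // k _; rewrite /geo big_ord_recl expr0 => /eqP.
rewrite -subr_eq0 addrAC subrr add0r.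
have -> : \sum_(i < k.+1) x ^+ lift ord0 i = x * \sum_(i < k.+1) x ^+ i.
  by rewrite mulr_sumr; apply: eq_bigr => i _; rewrite -exprS.
rewrite mulf_eq0 => /orP[/eqP|/eqP x0]; first by left.
by right; apply/eqP; rewrite -subr_eq0 subrX1 x0 mulr0.
Qed.

Lemma orbit_sum_id0 F : orbit_sum F 0 = F 0.
Proof.
rewrite /orbit_sum [undup _](_ : _ = [:: 0]) ?big_seq1 //.
apply: perm_small_eq => //; apply: uniq_perm; rewrite ?undup_uniq // => y.
rewrite mem_conjugates inE; apply/idP/eqP => [/algC_conjugate[nu <-] | ->].
  by rewrite rmorph0.
exact: galois_conj_refl.
Qed.

Lemma orbit_sumB F G x : orbit_sum (fun y => F y - G y) x = orbit_sum F x - orbit_sum G x.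
Proof. exact: sumrB. Qed.

(** Apply [geo_sum0] to x^j - x^j': its fibre sums are -1 + 1, and the multipliers [u] and [v]
    settle the k-th and the (k+2)-th roots of unity. *)
Lemma power_sums_eq k s j j' u v : (2 < k)%N -> galois_stable s ->
    {in s, forall x, exists2 m, (0 < m)%N & geo k x ^+ m = 1} ->
    (0 < j < k)%N -> (0 < j' < k)%N ->
    coprime u k -> (u * j = j' %[mod k])%N ->
    coprime v k.+2 -> (v * j = j' %[mod k.+2])%N ->
  \sum_(x <- s) x ^+ j = \sum_(x <- s) x ^+ j'.
Proof.
move=> k2 st_s unity jk j'k cou uj cov vj; have k0 : (0 < k)%N by lia.
apply/eqP; rewrite -subr_eq0 -sumrB; apply/eqP.
apply: (geo_sum0 k2 st_s unity) => [z | x xs x1 | x xs y _ _ yk].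
- by rewrite sumrB !sum_rootsC_geo_poly // subrr.
- have [-> | xk] := geo_eq1 k0 x1.
    by rewrite orbit_sum_id0 !expr0n !gtn_eqF ?subrr //; [case/andP: j'k | case/andP: jk].
  by rewrite orbit_sumB (orbit_sum_unity k0 xk cou uj) subrr.
by rewrite orbit_sumB (orbit_sum_unity _ yk cov vj) // subrr.
Qed.

Definition geo_unital k (s : seq algC) :=
  {in s, forall x, exists2 m, (0 < m)%N & geo k x ^+ m = 1}.

Lemma power_sums_exponent k d s j j' : (1 < d)%N -> 
    (forall i, (0 < i < k)%N -> \sum_(x <- s) x ^+ i = - d%:R ^+ i) ->
    (0 < j < k)%N -> (0 < j' < k)%N ->
  \sum_(x <- s) x ^+ j = \sum_(x <- s) x ^+ j' -> j = j'.
Proof.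
move=> d1 pws jk j'k; rewrite !pws // => /oppr_inj/eqP.
by rewrite -!natrX eqr_nat eqn_exp2l // => /eqP.
Qed.

Lemma no_power_sums_neq4 k d s : (2 < k)%N -> k != 4%N -> (1 < d)%N ->
    galois_stable s -> geo_unital k s ->
  ~ (forall j, (0 < j < k)%N -> \sum_(x <- s) x ^+ j = - d%:R ^+ j).
Proof.
move=> k2 k4 d1 st_s unity pws.
have absurd j j' u v : (0 < j < k)%N -> (0 < j' < k)%N -> j != j' ->
    coprime u k -> (u * j = j' %[mod k])%N ->
    coprime v k.+2 -> (v * j = j' %[mod k.+2])%N -> False.
  move=> jk j'k /eqP nj cou uj cov vj; apply: nj.
  apply: (power_sums_exponent d1 pws jk j'k).
  exact: (power_sums_eq k2 st_s unity jk j'k cou uj cov vj).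
(* For odd k, the multiplier 2 is a unit modulo both k and k + 2 and takes 1 to 2. *)
have [odd_k | even_k] := boolP (odd k).
  by apply: (absurd 1%N 2%N 2%N 2%N); rewrite ?coprime2n //= ?negbK //; lia.
have coq (q : nat) : (0 < q)%N -> coprime (2 * q - 1) (4 * q + 2).
  move=> q0; have -> : (4 * q + 2 = 2 * (2 * q - 1) + 2 ^ 2)%N by lia.
  rewrite /coprime gcdnMDl -/(coprime _ _) coprimeXr // coprimen2; lia.
have [[q Dk] | [q Dk]] : (exists q : nat, k = 4 * q)%N \/ (exists q : nat, k = 4 * q + 2)%N.
- have : (k %% 4 = 0 \/ k %% 4 = 2)%N by lia.
  by move=> [] km; [left | right]; exists (k %/ 4)%N; lia.
(* For k = 4q, the exponents 2 and k - 2 are linked by -1 modulo k and by k/2 - 1 modulo k + 2; they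
   differ because k is not 4. *)
- have c1 : coprime (k - 1) k by rewrite subn1 coprime_sym coprimenP; lia.
  have c2 : coprime (2 * q - 1) k.+2.
    by rewrite (_ : k.+2 = 4 * q + 2)%N; [apply: coq; lia | lia].
  apply: (absurd 2%N (k - 2)%N (k - 1)%N (2 * q - 1)%N) => //; try lia.
    by rewrite (_ : (k - 1) * 2 = k - 2 + k)%N ?modnDr //; lia.
  by congr (_ %% _)%N; lia.
(* For k = 6 the general choice k - 2 and 4 would coincide; 1 and 5 are used, 5 being a unit modulo
   6 and 8. *)
have [q1 | q1] := eqVneq q 1%N.
  by rewrite q1 in Dk; subst k; apply: (absurd 1%N 5%N 5%N 5%N).
(* For other k = 4q + 2, the exponents k - 2 and 4 are linked by k/2 - 2 modulo k and by -1 modulo k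
   + 2. *)
have c1 : coprime (2 * q - 1) k by rewrite Dk; apply: coq; lia.
have c2 : coprime k.+1 k.+2 by rewrite coprimenS.
apply: (absurd (k - 2)%N 4%N (2 * q - 1)%N k.+1) => //; try lia.
  have -> : ((2 * q - 1) * (k - 2) = (2 * q - 2) * k + 4)%N by rewrite Dk; nia.
  by rewrite modnMDl.
have -> : (k.+1 * (k - 2) = (4 * q - 1) * k.+2 + 4)%N by rewrite Dk; nia.
by rewrite modnMDl.
Qed.

(** * Power sums for k = 4 *)

Lemma natr_exp_eq1 (n m : nat) : (1 < n)%N -> (0 < m)%N -> n%:R ^+ m != 1 :> algC.
Proof.
by move=> n1 m0; rewrite -natrX (eqr_nat _ _ 1) -[1%N](expn0 n) eqn_exp2l // gtn_eqF.
Qed.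

Lemma geo1 k : geo k 1 = k.+1%:R.
Proof. by rewrite /geo; under eq_bigr do rewrite expr1n; rewrite sumr_const card_ord. Qed.

(* Chosen so that its sum vanishes over the roots of [geo_poly 4 z] for every [z],
   and over the primitive third and sixth roots of unity. *)
Definition cubic x : algC := 3 + 4 * x + 6 * x ^+ 2 + 2 * x ^+ 3.

(** Here y is a primitive third or sixth root of unity, according to [b]. The values of [cubic] at a
    conjugate of y and at its complex conjugate cancel, so twice the orbit sum is 0. *)
Lemma orbit_sum_cubic (b : bool) y :
  y ^+ 2 + (-1) ^+ b * y + 1 = 0 -> orbit_sum cubic y = 0.
Proof.
move=> y0; have n20 : 2%:R != 0 :> algC by rewrite pnatr_eq0.
apply: (mulfI n20); rewrite mulr0.
set S := orbit_sum cubic y; have SC : S = \sum_(w <- undup (rootsC (minCpoly y))) cubic w^*.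
  by rewrite /S /orbit_sum -(perm_big _ (galois_stable_conjugates y Num.conj)) big_map.
rewrite mulr_natl mulr2n {2}SC -big_split /= big_seq big1 // => w.
rewrite mem_conjugates => /algC_conjugate[nu nuy].
have w0 : w ^+ 2 + (-1) ^+ b * w + 1 = 0.
  by have := congr1 nu y0; rewrite !rmorphD rmorphXn rmorphM rmorph_sign rmorph1
    rmorph0 nuy.
set e := (-1) ^+ b in w0; have e2 : e ^+ 2 = 1 by rewrite sqrr_sign.
have w2 : w ^+ 2 = - e * w - 1 by rewrite -[LHS]subr0 -w0; ring.
have w3 : w ^+ 3 = e.
  transitivity (e ^+ 2 * w + e - w); last by rewrite e2; ring.
  by rewrite exprS w2 mulrBr mulr1 mulrCA -expr2 w2; ring.
have w6 : w ^+ 6 = 1 by rewrite (exprM _ 3 2) w3.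
have wV : w^* = w^-1 by apply: (@unity_conjC _ 6).
have wn0 : w != 0 by apply: contra_eq_neq w6 => ->; rewrite expr0n eq_sym oner_eq0.
have wC : w^* = - e - w.
  by rewrite wV; apply: (mulIf wn0); rewrite mulVf // mulrBl -expr2 w2; ring.
have v3 : w^* ^+ 3 = e by rewrite -rmorphXn w3 rmorph_sign.
have v2 : w^* ^+ 2 = e * w by rewrite wC; transitivity (e ^+ 2 + 2 * e * w + w ^+ 2);
  [ring | rewrite e2 w2; ring].
by rewrite /cubic w3 v3 w2 v2 wC; ring.
Qed.

Lemma geo4_order6 y : geo 4 y != 1 -> y ^+ 6 = 1 -> y != 1 ->
  exists b : bool, y ^+ 2 + (-1) ^+ b * y + 1 = 0.
Proof.
move=> gy y6 y1; have yN1 : y != -1.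
  by apply: contraNneq gy => ->; rewrite /geo !big_ord_recl big_ord0 /bump /=;
    apply/eqP; ring.
have : (y - 1) * (y + 1) * ((y ^+ 2 + (-1) ^+ false * y + 1) * (y ^+ 2 + (-1) ^+ true *
  y + 1)) = 0.
  by transitivity (y ^+ 6 - 1); [rewrite expr0 expr1; ring | rewrite y6 subrr].
move/eqP; rewrite !mulf_eq0 subr_eq0 addr_eq0 (negPf y1) (negPf yN1) /= => /orP[] /eqP E.
  by exists false.
by exists true.
Qed.

Lemma galois_conj_unity z w m : galois_conj z w -> z ^+ m = 1 -> w ^+ m = 1.
Proof. by case/algC_conjugate=> nu <- zm; rewrite -rmorphXn zm rmorph1. Qed.

Lemma geo4E x : geo 4 x = 1 + x + x ^+ 2 + x ^+ 3 + x ^+ 4.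
Proof. by rewrite /geo !big_ord_recl big_ord0 /bump /=; ring. Qed.

Lemma geo4_unity6 y : y ^+ 6 = 1 -> y != 1 -> geo 4 y = - y ^+ 5.
Proof.
move=> y6 y1; have y10 : y - 1 != 0 by rewrite subr_eq0.
by apply: (mulfI y10); rewrite geo4E; transitivity (y ^+ 6 - 1 + (y - 1) * - y ^+ 5);
  [ring | rewrite y6; ring].
Qed.

(** The exponents 1 and 3 agree on 0 and on fourth roots of unity. Only sixth roots of unity y can
    separate them, and q(y) = - y^5 then has order 3 or 6. If no eigenvalue had such a q(x), then d
    = d^3. *)
Lemma exists_order6 d s : (1 < d)%N -> galois_stable s -> geo_unital 4 s ->
    (forall j, (0 < j < 4)%N -> \sum_(x <- s) x ^+ j = - d%:R ^+ j) ->
  exists2 x, x \in s & (geo 4 x ^+ 6 == 1) && (geo 4 x ^+ 2 != 1).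
Proof.
move=> d1 st_s unity pws; apply/hasP/negPn/negP => /hasPn no6.
suff : 1%N = 3%N by [].
apply: (power_sums_exponent d1 pws) => //.
apply/eqP; rewrite -subr_eq0 -sumrB; apply/eqP.
apply: (geo_sum0 _ st_s unity) => // [z | x xs x1 | x xs y y1 gxy y6].
- by rewrite sumrB !sum_rootsC_geo_poly // subrr.
- have [-> | xk] := geo_eq1 (isT : (0 < 4)%N) x1;
  first by rewrite orbit_sum_id0 !expr0n subrr.
  by rewrite orbit_sumB (@orbit_sum_unity 4 1 3 3) // subrr.
have [m m0 xm] := unity x xs; have ym := galois_conj_unity gxy xm.
have yn1 : y != 1.
  by apply: contra_eq_neq ym => ->; rewrite geo1 natr_exp_eq1.
have gy := geo4_unity6 y6 yn1.
have /algC_conjugate[nu nuE] := gxy.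
have gx6 : geo 4 x ^+ 6 = 1.
  apply: (fmorph_inj nu); rewrite rmorphXn nuE gy rmorph1.
  by transitivity ((y ^+ 6) ^+ 5); [ring | rewrite y6 expr1n].
have := no6 x xs; rewrite gx6 eqxx negbK => /eqP gx2.
have y10 : y ^+ 10 = 1.
  by have := congr1 nu gx2; rewrite rmorphXn nuE gy rmorph1 => <-; ring.
have [b y2] := geo4_order6 y1 y6 yn1.
have y2' : y ^+ 2 = 1.
  transitivity (y ^+ 10 * y ^+ 2); first by rewrite y10 mul1r.
  by rewrite -exprD (exprM _ 6 2) y6 expr1n.
exfalso; move/eqP: y2'; rewrite sqrf_eq1 (negPf yn1) /= => /eqP yN.
by move: y1; rewrite geo4E yN => /eqP; apply; ring.
Qed.

(** In the sum of [cubic] over [s], the elements with q(x) <> 1 cancel. The others are 0, -1 or a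
    square root of -1, where [cubic] has real part 3, 3 or -3. *)
Lemma cubic_bound d n s : galois_stable s -> geo_unital 4 s -> size s = n ->
    (forall j, (0 < j < 4)%N -> \sum_(x <- s) x ^+ j = - d%:R ^+ j) ->
  (3 * n <= 3 * count (fun x => geo 4 x == 1)%R s + 4 * d + 6 * d ^ 2 + 2 * d ^ 3)%N.
Proof.
move=> st_s unity sn pws; pose P := [pred x | geo 4 x == 1].
have Paut (nu : {rmorphism algC -> algC}) x : P (nu x) = P x.
  by rewrite /= -geo_aut -{1}(rmorph1 nu) (inj_eq (fmorph_inj nu)).
pose A := \sum_(x <- s | P x) cubic x.
have sum_cubic : \sum_(x <- s) cubic x = 3 * n%:R - 4 * d%:R - 6 * d%:R ^+ 2 - 2 * d%:R
  ^+ 3.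
  rewrite !big_split /= -!mulr_sumr !pws // big_const_seq iter_addr_0 count_predT sn.
  have := pws 1%N isT; under eq_bigr do rewrite expr1; move=> ->; rewrite -mulr_natr; ring.
have DA : A = 3 * n%:R - 4 * d%:R - 6 * d%:R ^+ 2 - 2 * d%:R ^+ 3.
  rewrite -sum_cubic (bigID P) /= -/A -[X in _ + X]big_filter.
  rewrite [X in _ + X](_ : _ = 0) ?addr0 //.
  apply: (@geo_sum0 _ 4) => // [|x|z|x|x].
  - by apply: galois_stable_filter => // nu x; congr (~~ _); apply: Paut.
  - by rewrite mem_filter => /andP[_ /unity].
  - rewrite !big_split /= -!mulr_sumr !(@sum_rootsC_geo_poly 4) //.
    have -> : \sum_(w <- rootsC (geo_poly 4 z)) w = -1 by exact: (@sum_rootsC_geo_poly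
      4 z 1).
    by rewrite big_const_seq iter_addr_0 count_predT size_rootsC_geo_poly //; ring.
  - by rewrite mem_filter /= => /andP[/eqP].
  rewrite mem_filter => /andP[_ /unity[m m0 xm]] y y1 gxy y6.
  have yn1 : y != 1.
    by apply: contra_eq_neq (galois_conj_unity gxy xm) => ->; rewrite geo1 natr_exp_eq1.
  by have [b /orbit_sum_cubic] := geo4_order6 y1 y6 yn1.
have Areal : A^* = A.
  by rewrite DA !(rmorphXn, rmorphB, rmorphM, rmorph_nat).
have : A + A^* <= (6 * count P s)%:R.
  have -> : (6 * count P s)%:R = \sum_(x <- s | P x) (6%:R : algC).
    by rewrite big_const_seq iter_addr_0 natrM mulr_natr.
  rewrite rmorph_sum -big_split /=.
  rewrite big_seq_cond [leRHS]big_seq_cond; apply: ler_sum => x /andP[xs /eqP gx].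
  have [m m0 xm] := unity x xs.
  have xn1 : x != 1.
    by apply: contra_eq_neq xm => ->; rewrite geo1 natr_exp_eq1.
  have [-> | x4] := geo_eq1 (isT : (0 < 4)%N) gx.
    by rewrite /cubic !expr0n /= !mulr0 !addr0 conjC_nat -natrD.
  have : (x - 1) * ((x + 1) * (x ^+ 2 + 1)) = 0.
    by transitivity (x ^+ 4 - 1); [ring | rewrite x4 subrr].
  move/eqP; rewrite mulf_eq0 subr_eq0 (negPf xn1) mulf_eq0 !addr_eq0 /=.
  case/orP=> /eqP x2.
    rewrite x2 /cubic !(rmorphXn, rmorphD, rmorphM, rmorphN, rmorph1, rmorph_nat) /=.
    rewrite le_eqVlt; apply/orP; left; apply/eqP; ring.
  have xn0 : x != 0 by apply: contra_eq_neq x4 => ->; rewrite expr0n eq_sym oner_eq0.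
  have xC : x^* = - x.
    by rewrite (@unity_conjC _ 4) //; apply: (mulIf xn0);
      rewrite mulVf // mulNr -expr2 x2 opprK.
  rewrite /cubic !(rmorphXn, rmorphD, rmorphM, rmorph_nat) /= xC.
  rewrite -subr_ge0; set D := _ - _; have -> : D = 12.
    transitivity (- 12 * x ^+ 2 : algC); rewrite /D; last by rewrite x2; ring.
    ring.
  exact: ler0n.
rewrite Areal DA -subr_ge0.
set D := _ - _; have -> : D = 2 * ((3 * count P s + 4 * d + 6 * d ^ 2 + 2 * d ^ 3)%:R -
  (3 * n)%:R).
  by rewrite /D !(natrX, natrD, natrM); ring.
by rewrite pmulr_rge0 ?ltr0n // subr_ge0 ler_nat.
Qed.

(** * The spectrum *)

Lemma horner_mx_trig n (A : 'M[algC]_n.+1) (p : {poly algC}) : is_trig_mx A ->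
  is_trig_mx (horner_mx A p) /\ forall i, horner_mx A p i i = p.[A i i].
Proof.
move=> /is_trig_mxP tA; elim/poly_ind: p => [|p c [/is_trig_mxP tp dp]].
  by rewrite rmorph0; split=> [|i]; [apply: mx0_is_trig | rewrite mxE horner0].
rewrite rmorphD rmorphM /= horner_mx_X horner_mx_C; split=> [|i].
  apply/is_trig_mxP => i j ij; rewrite !mxE -val_eqE /= ltn_eqF // mulr0n addr0 big1 //
    => l _.
  by have [li | il] := leqP l i; [rewrite tA ?mulr0 ?(leq_ltn_trans li) | rewrite tp
    ?mul0r].
rewrite !mxE eqxx mulr1n hornerMXaddC -dp (bigD1 i) //= big1 ?addr0 // => l.
by rewrite -val_eqE /= neq_ltn => /orP[] il; [rewrite tA ?mulr0 | rewrite tp ?mul0r].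
Qed.

(** By Schur's theorem [A] is similar to a triangular matrix, and [s] lists its diagonal. *)
Lemma mx_spectrum n (A : 'M[algC]_n.+1) : exists s : seq algC,
  [/\ size s = n.+1, char_poly A = \prod_(x <- s) ('X - x%:P),
      forall p, \tr (horner_mx A p) = \sum_(x <- s) p.[x]
    & forall p, horner_mx A p = 0 -> {in s, forall x, p.[x] = 0}].
Proof.
have [P Pu] := Schur A (ltn0Sn n); have uP := unitarymx_unit Pu.
rewrite /similar_to conjumx // => tT; set T := P *m A *m invmx P in tT.
have hT p : horner_mx T p = P *m horner_mx A p *m invmx P by apply: horner_mx_uconj.
exists [seq T i i | i <- enum 'I_n.+1]; split.
- by rewrite size_map size_enum_ord.
- rewrite big_map big_enum /= -char_poly_trig // /char_poly.
  have -> : char_poly_mx T = map_mx polyC P *m char_poly_mx A *m map_mx polyC (invmx P).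
    rewrite /char_poly_mx mulmxBr mulmxBl scalar_mxC -['X%:M *m _ *m _]mulmxA -!map_mxM
      /= mulmxV //.
    by rewrite map_mx1 mulmx1.
  rewrite !det_mulmx mulrC mulrA -det_mulmx -map_mxM mulVmx //.
  by rewrite map_mx1 det1 mul1r.
- move=> p; have [_ dT] := horner_mx_trig p tT.
  rewrite big_map big_enum /= (eq_bigr (fun i => horner_mx T p i i)) => [|i _];
    last by rewrite dT.
  by rewrite -/(\tr _) hT mxtrace_mulC mulmxA mulVmx // mul1mx.
move=> p p0 _ /mapP[i _ ->]; have [_ <-] := horner_mx_trig p tT.
by rewrite hT p0 mulmx0 mul0mx mxE.
Qed.

Lemma char_poly_galois_stable n (A : 'M[algC]_n) (s : seq algC) :
    (forall i j, A i j \in Crat) -> char_poly A = \prod_(x <- s) ('X - x%:P) ->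
  galois_stable s.
Proof.
move=> QA DA nu; apply: prod_XsubC_eq; rewrite -DA.
have -> : char_poly A = map_poly nu (char_poly A).
  rewrite map_char_poly; congr char_poly; apply/matrixP=> i j.
  by rewrite mxE aut_Crat.
rewrite DA rmorph_prod /= big_map.
by apply: eq_bigr => w _; rewrite map_polyXsubC.
Qed.

Section Spectrum.
Variables (d k : nat) (T : finType) (e : rel T).
Hypotheses (d1 : (1 < d)%N) (k2 : (2 < k)%N) (amd : almost_moore_digraph d k e).
Local Notation r := (repeat k e).

Lemma repeat_period : exists2 c, (0 < c)%N & forall v, iter c r v = v.
Proof.
have r_inj := repeat_inj d1 k2 amd.
exists (\prod_v order r v)%N; first by rewrite prodn_gt0 // => v; apply: order_gt0.
move=> v; rewrite (bigD1 v) //= mulnC iterM.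
by elim: (X in iter X _ _) => //= m IHm; rewrite IHm iter_order.
Qed.

(* The spectrum of [A - (d/n) J]; the correction by [J] replaces the eigenvalue
   [d] of the adjacency matrix by [0]. *)
Lemma amd_spectrum : exists s : seq algC,
  [/\ size s = #|T|, galois_stable s,
      forall c, (forall v, iter c r v = v) -> {in s, forall x, geo k x ^+ c = 1},
      forall j, (0 < j < k)%N -> \sum_(x <- s) x ^+ j = - d%:R ^+ j
    & forall c, \sum_(x <- s) geo k x ^+ c = #|[pred v | iter c r v == v]|%:R].
Proof.
have cardT := amd_card amd; have T_gt0 : (0 < #|T|)%N.
  rewrite cardT muln_gt0 (ltnW d1) /=; case: (k) k2 => // k' _.
  by rewrite big_ord_recl addn_gt0 expn_gt0 (ltnW d1).
pose n := #|T|.-1; have Tn : n.+1 = #|T| by rewrite prednK.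
pose f (i : 'I_n.+1) : T := enum_val (cast_ord Tn i).
have f_bij : bijective f.
  exists (fun v => cast_ord (esym Tn) (enum_rank v)) => v.
    by rewrite enum_valK cast_ordK.
  by rewrite /f cast_ordKV enum_rankK.
have f_inj := bij_inj f_bij.
have sumf (R : nmodType) (F : T -> R) : \sum_i F (f i) = \sum_v F v.
  by rewrite [RHS](reindex f) //; apply: onW_bij.
pose N : algC := n.+1%:R; have N0 : N != 0 by rewrite pnatr_eq0.
pose A : 'M[algC]_n.+1 := \matrix_(i, j) (e (f i) (f j))%:R.
pose J c : 'M[algC]_n.+1 := const_mx c.
pose B := A - J (d%:R / N).
have AE m i j : (A ^+ m) i j = (walks e m (f i) (f j))%:R.
  elim: m i => [|m IHm] i; first by rewrite expr0 mxE /= (inj_eq f_inj).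
  rewrite exprS mxE /= natr_sum -sumf; apply: eq_bigr => l _.
  by rewrite mxE IHm natrM.
have AJ c : A *m J c = J (d%:R * c).
  apply/matrixP=> i j; rewrite !mxE -(amd_outdeg d1 k2 amd (f i)) outdegE natr_sum
    mulr_suml -sumf.
  by apply: eq_bigr => l _; rewrite !mxE.
have JA m c : J c *m A ^+ m = J (d%:R ^+ m * c).
  apply/matrixP=> i j; rewrite !mxE -natrX -(sum_walks_in (amd_indeg d1 k2 amd) m (f
    j)) natr_sum mulr_suml -sumf.
  by apply: eq_bigr => l _; rewrite mxE AE mulrC.
have JJ c c' : J c *m J c' = J (N * (c * c')).
  apply/matrixP=> i j; rewrite !mxE (eq_bigr (fun=> c * c')) => [|l _];
    last by rewrite !mxE.
  by rewrite sumr_const card_ord mulr_natl.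
(* The exponent must be positive: B^0 is the identity, without a correction by J. *)
have BE m : B ^+ m.+1 = A ^+ m.+1 - J (d%:R ^+ m.+1 / N).
  elim: m => [|m IHm]; first by rewrite !expr1.
  rewrite exprS IHm /B mulrBl !mulrBr [A ^+ m.+2]exprS.
  rewrite -![_ * J _]/(_ *m J _) AJ JJ -[J _ * _]/(J _ *m _) JA.
  have JB a b c : J a - (J b - J c) = J (a - (b - c)) by apply/matrixP=> i j; rewrite !mxE.
  rewrite -addrA -opprD; congr (_ - _); apply/matrixP=> i j; rewrite !mxE.
  by rewrite !exprS; field; rewrite nat1r.
pose g : {poly algC} := \sum_(m < k.+1) 'X^m.
have gE x : g.[x] = geo k x by rewrite horner_sum; apply: eq_bigr => m _; rewrite hornerXn.
pose P : 'M[algC]_n.+1 := horner_mx B g.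
(* Since d + ... + d^k is the order, the corrections add up to the all-one matrix, which leaves the
   permutation matrix of the repeats. *)
have PE i j : P i j = (f j == r (f i))%:R.
  rewrite /P rmorph_sum summxE big_ord_recl rmorphXn /= horner_mx_X expr0.
  rewrite (eq_bigr (fun m : 'I_k =>
    (walks e m.+1 (f i) (f j))%:R - d%:R ^+ m.+1 / N)) => [|m _]; last first.
    by rewrite rmorphXn /= horner_mx_X BE mxE AE !mxE.
  rewrite sumrB -mulr_suml.
  have -> : \sum_(m < k) (d%:R : algC) ^+ m.+1 = N.
    rewrite /N Tn cardT big_distrr natr_sum; apply: eq_bigr => m _.
    by rewrite /= -expnS natrX.
  rewrite divff // -natr_sum mxE -(inj_eq f_inj) addrA -natrD.
  have := amd_repeat d1 k2 amd (f i) (f j); rewrite big_ord_recl /= => ->.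
  by rewrite -addn1 natrD addrK.
have PcE c i j : (P ^+ c) i j = (f j == iter c r (f i))%:R.
  elim: c i => [|c IHc] i; first by rewrite expr0 mxE /= (inj_eq f_inj) eq_sym.
  have [f' fK f'K] := f_bij.
  rewrite exprS mxE (bigD1 (f' (r (f i)))) //= big1 => [|l].
    by rewrite PE IHc f'K eqxx mul1r addr0 -iterSr.
  by rewrite PE -{2}[r (f i)]f'K (inj_eq f_inj) => /negPf->; rewrite mul0r.
have [s [sz charB trB annB]] := mx_spectrum B.
exists s; split.
- by rewrite sz Tn.
- apply: char_poly_galois_stable charB => i j; rewrite !mxE.
  by rewrite rpredB ?rpred_div ?rpred_nat.
- move=> c rc x xs; apply/eqP; rewrite -subr_eq0 -gE -horner_exp -(hornerC 1 x)
  -hornerN -hornerD.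
  apply/eqP; apply: annB xs; rewrite rmorphB rmorphXn rmorph1 /= -/P.
  by apply/matrixP=> i j; rewrite mxE PcE rc !mxE (inj_eq f_inj) eq_sym subrr.
- case=> // j jk; rewrite (eq_bigr (fun x => ('X^(j.+1)).[x])) => [|x _];
  last by rewrite hornerXn.
  rewrite -trB rmorphXn /= horner_mx_X BE mxtraceD.
  rewrite [X in X + _](_ : _ = 0); last first.
    by rewrite /mxtrace big1 // => i _; rewrite AE (amd_girth d1 k2 amd).
  rewrite add0r raddfN /=; congr (- _).
  rewrite /mxtrace (eq_bigr (fun=> d%:R ^+ j.+1 / N)) => [|i _]; last by rewrite mxE.
  by rewrite sumr_const card_ord -[LHS]mulr_natr -/N divfK.
move=> c; rewrite (eq_bigr (fun x => (g ^+ c).[x])) => [|x _];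
  last by rewrite horner_exp gE.
rewrite -trB rmorphXn /= -/P -sum1_card natr_sum [RHS]big_mkcond /= -sumf.
by apply: eq_bigr => i _; rewrite PcE eq_sym inE; case: (_ == _).
Qed.

End Spectrum.

Section DiameterFour.
Variables (d : nat) (T : finType) (e : rel T).
Hypotheses (d1 : (1 < d)%N) (amd : almost_moore_digraph d 4 e).
Local Notation r := (repeat 4 e).

(* [bound] bounds the multiplicity [m] of [z = 1] from below; summing the
   nonnegative numbers [|1 + z|^2], or [|1 + z + z^2|^2] when [d = 2], bounds it
   from above. *)
Lemma no_almost_moore4 : False.
Proof.
have k2 : (2 < 4)%N by [].
have [s [sz st_s geo_r pws tr_r]] := amd_spectrum d1 k2 amd.
have unity : geo_unital 4 s.
  by move=> x xs; have [c c0 cE] := repeat_period d1 k2 amd; exists c => //;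
    apply: geo_r xs.
have [x0 x0s /andP[/eqP x0_6 x0_2]] := exists_order6 d1 st_s unity pws.
(* Otherwise the order of [geo 4 x0] would divide gcd(2^t, 6), hence 2. *)
have no_pow2 t : ~ forall v, iter (2 ^ t) r v = v.
  move=> /geo_r/(_ x0 x0s) x0t; case/negP: x0_2; rewrite -dvdn_orderC.
  have : (#[geo 4 x0]%C %| gcdn (2 ^ t) 6)%N by rewrite dvdn_gcd !dvdn_orderC x0t x0_6 eqxx.
  move/dvdn_trans; apply; rewrite (_ : 6 = 2 * 3)%N // Gauss_gcdl ?dvdn_gcdr //.
  by rewrite coprimeXl.
have norm1 x : x \in s -> geo 4 x * (geo 4 x)^* = 1.
  move=> xs; have [m m0 xm] := unity x xs; rewrite (unity_conjC m0 xm) divff //.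
  by apply: contra_eq_neq xm => ->; rewrite expr0n gtn_eqF // eq_sym oner_eq0.
pose m := count (fun x => geo 4 x == 1) s.
have bound : (3 * #|T| <= 3 * m + 4 * d + 6 * d ^ 2 + 2 * d ^ 3)%N by apply: cubic_bound.
have cardT : #|T| = (d + d ^ 2 + d ^ 3 + d ^ 4)%N.
  by rewrite (amd_card amd) !big_ord_recl big_ord0 /bump /=; ring.
have sum_conj c : \sum_(x <- s) (geo 4 x)^* ^+ c = #|[pred v | iter c r v == v]|%:R.
  rewrite -tr_r -[RHS]conjCK tr_r rmorph_nat -tr_r rmorph_sum.
  by apply: eq_bigr => x _; rewrite rmorphXn.
have sum1 c : \sum_(x <- s) (c : algC) = c * #|T|%:R.
  by rewrite big_const_seq iter_addr_0 count_predT sz mulr_natr.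
have sum_m c : \sum_(x <- s | geo 4 x == 1) (c : algC) = c * m%:R.
  by rewrite big_const_seq iter_addr_0 mulr_natr.
pose m1 := #|[pred v | r v == v]|.
(* The numbers |1 + z|^2 add up to 2 (n + m1), of which z = 1 takes 4 m; strictness comes from [x0],
   where z is neither 1 nor -1. *)
have bound1 : (2 * m < #|T| + m1)%N.
  have FE x : x \in s -> 2 + geo 4 x + (geo 4 x)^* = `|1 + geo 4 x| ^+ 2.
    move=> xs; rewrite normCK rmorphD rmorph1.
    transitivity (1 + geo 4 x + (geo 4 x)^* + geo 4 x * (geo 4 x)^*); last by ring.
    by rewrite norm1 //; ring.
  have F_ge0 x : x \in s -> 0 <= 2 + geo 4 x + (geo 4 x)^*.
    by move=> /FE->; rewrite exprn_ge0.
  have : \sum_(x <- s) (2 + geo 4 x + (geo 4 x)^*) = 2 * (#|T| + m1)%:R.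
    have S1 : \sum_(x <- s) geo 4 x = m1%:R by rewrite -(tr_r 1%N).
    have S2 : \sum_(x <- s) (geo 4 x)^* = m1%:R by rewrite -(sum_conj 1%N).
    by rewrite !big_split /= sum1 S1 S2 natrD; ring.
  rewrite (bigID (fun x => geo 4 x == 1)) /=.
  have -> : \sum_(x <- s | geo 4 x == 1) (2 + geo 4 x + (geo 4 x)^*) = 4 * m%:R.
    by rewrite -sum_m; apply: eq_bigr => x /eqP->; rewrite rmorph1; ring.
  set R := \sum_(x <- s | _) _ => E.
  have : 0 < R.
    rewrite lt_def /R big_seq_cond sumr_ge0 ?andbT => [|x /andP[/F_ge0]//].
    apply/negP; rewrite psumr_eq0 => [/allP/(_ x0 x0s)|x /andP[/F_ge0]//].
    rewrite x0s /=; have -> /= : geo 4 x0 != 1 by apply: contraNneq x0_2 => ->;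
      rewrite expr1n.
    rewrite FE // expf_eq0 normr_eq0 addrC addr_eq0 /= => /eqP x0N.
    by case/negP: x0_2; rewrite x0N sqrrN expr1n.
  have -> : R = (2 * (#|T| + m1))%:R - (4 * m)%:R by rewrite natrM -E natrM; ring.
  by rewrite subr_gt0 ltr_nat -[4%N]/(2 * 2)%N -mulnA ltn_pmul2l.
have moved : #|[pred v | r v != v]| = (#|T| - m1)%N.
  rewrite /m1 -(cardC [pred v | r v == v]) addKn; apply: eq_card => v.
  by rewrite !inE.
have m1T : (m1 <= #|T|)%N by apply: max_card.
(* For d > 2, [repeat_moved] gives n - m1 >= 2 (1 + d + d^2 + d^3), while the two bounds give 3 (n -
   m1) < 8 d + 12 d^2 + 4 d^3. Together they say (d - 3)(d^2 - 1) < 0. *)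
have [d2 | d2] := ltnP 2 d.
  have [/existsP rv | ] := boolP [exists v, r v != v]; last first.
    rewrite negb_exists => /forallP r_id; apply: (no_pow2 0%N) => v.
    by apply/eqP; rewrite /= -[_ == _]negbK r_id.
  have := repeat_moved d1 k2 amd rv; rewrite moved !big_ord_recl big_ord0 /bump /=.
  move: bound bound1 m1T d2; rewrite cardT !expnS expn0; clear; nia.
have d2E : d = 2%N by apply/eqP; rewrite eqn_leq d1 d2.
(* For d = 2, either r has an order that is a power of 2, or neither r nor its square fixes a vertex
   and the traces of P and P^2 vanish. *)
have [/existsP[v /eqP rrv] | ] := boolP [exists v, r (r v) == v].
  by have [t tP] := repeat_order_pow2 d1 k2 amd d2E rrv; apply: (no_pow2 t).
rewrite negb_exists => /forallP no2.
have fix1 : \sum_(x <- s) geo 4 x = 0.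
  transitivity (\sum_(x <- s) geo 4 x ^+ 1) => //.
  rewrite tr_r eq_card0 // => v; rewrite !inE /=; apply/eqP => rv.
  by have := no2 v; rewrite !rv eqxx.
have fix2 : \sum_(x <- s) geo 4 x ^+ 2 = 0.
  by rewrite tr_r eq_card0 // => v; exact: negbTE (no2 v).
have conj0 c : \sum_(x <- s) geo 4 x ^+ c = 0 -> \sum_(x <- s) (geo 4 x)^* ^+ c = 0.
  by move=> E; rewrite sum_conj -tr_r.
(* The numbers |1 + z + z^2|^2 add up to 3 n, and z = 1 takes 9 m. With n = 30 this gives m <= 10,
   whereas [bound] gives m >= 14. *)
have : (9 * m)%:R <= (3 * #|T|)%:R :> algC.
  rewrite !natrM -sum_m -sum1.
  have -> : \sum_(x <- s) 3 = \sum_(x <- s) `|1 + geo 4 x + geo 4 x ^+ 2| ^+ 2.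
    transitivity (\sum_(x <- s) (3 + 2 * geo 4 x + 2 * (geo 4 x)^* ^+ 1 + geo 4 x ^+ 2
      + (geo 4 x)^* ^+ 2)).
      rewrite !big_split /= -!mulr_sumr fix1 fix2 !conj0 ?mulr0 ?addr0 //.
    rewrite big_seq [RHS]big_seq; apply: eq_bigr => x xs.
    rewrite normCK !rmorphD rmorph1 rmorphXn /=.
    set z := geo 4 x in xs *; set w := z^*; have zw : z * w = 1 by apply: norm1.
    transitivity (1 + z + z ^+ 2 + (w + z * w + z * (z * w)) + (w ^+ 2 + w * (z * w) +
      (z * w) ^+ 2)); last by ring.
    by rewrite zw; ring.
  rewrite [leRHS](bigID (fun x => geo 4 x == 1)) /=.
  rewrite [X in _ <= X + _](eq_bigr (fun=> 9)) => [|x /eqP->]; last first.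
    by rewrite expr1n (_ : 1 + 1 + 1 = 3%:R) ?normr_nat -?natrX //; ring.
  by rewrite lerDl sumr_ge0 // => x _; rewrite exprn_ge0.
rewrite ler_nat; move: bound; rewrite cardT d2E; lia.
Qed.

End DiameterFour.

Local Close Scope ring_scope.
Unset Implicit Arguments.

Theorem theorem1p5 (d k : nat) (hd : 1 < d) (hk : 2 < k) :
  ~ exists (T : finType) (e : rel T), almost_moore_digraph d k e.
Proof.
case=> T [e amd]; have [k4 | k4] := eqVneq k 4.
  by rewrite k4 in amd; apply: (no_almost_moore4 hd amd).
have [s [_ st_s geo_r pws _]] := amd_spectrum hd hk amd.
apply: (no_power_sums_neq4 hk k4 hd st_s) pws => x xs.
by have [c c0 cE] := repeat_period hd hk amd; exists c => //; apply: geo_r xs.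
Qed.
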